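(* Let $M$ be a (nonempty) smooth manifold and $T^2$ the two-torus. There exist pairs of diffeomorphisms of $M\times T^2$ that are conjugated by a homeomorphism of $M\times T^2$ but not by any $C^1$-diffeomorphism of $M\times T^2$. If moreover $M$ supports a volume form $\mu$, and $M\times T^2$ is equipped with the product volume form $\mu\wedge dx\wedge dy$, then there are such pairs of diffeomorphisms (conjugated by a homeomorphism but not by any $C^1$-diffeomorphism) which in addition are volume preserving, and the conjugating homeomorphism may also be chosen to preserve volume.
   Context: Two maps $\phi_1,\phi_2$ are conjugated by a homeomorphism (or diffeomorphism) $\psi$ if $\psi\circ\phi_1\circ\psi^{-1}=\phi_2$. Here $dx\wedge dy$ denotes the standard area form on $T^2$; a homeomorphism preserves volume if it preserves the measure induced by the volume form. All diffeomorphisms, unless stated otherwise, are smooth ($C^\infty$). *)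

(* Defs.v *)
From HB Require Import structures.
From mathcomp Require Import all_boot all_order all_algebra generic_quotient.
From mathcomp Require Import all_classical all_reals all_analysis.

Set Implicit Arguments.
Unset Strict Implicit.
Unset Printing Implicit Defensive.

Import Order.TTheory GRing.Theory Num.Theory.
Import numFieldNormedType.Exports.

Local Open Scope classical_set_scope.
Local Open Scope ring_scope.
Local Open Scope quotient_scope.

(* C^k on an open set [U] of R^m, by induction on [k]: all directional (hence
   all partial) derivatives of order at most [k] exist and are continuous. *)
Fixpoint Ck_on (R : realType) (m n : nat) (k : nat) (U : set 'rV[R]_m)
    (f : 'rV[R]_m -> 'rV[R]_n) : Prop :=
  match k with
  | 0 => {in U, continuous f}
  | k'.+1 => {in U, forall x, differentiable f x} /\
             forall v : 'rV[R]_m, Ck_on k' U (fun x => 'D_v f x)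
  end.

Definition smooth_on (R : realType) (m n : nat) (U : set 'rV[R]_m)
  (f : 'rV[R]_m -> 'rV[R]_n) : Prop := forall k, Ck_on k U f.

(* Both maps are total functions; only the values of [chart_map] on [chart_dom]
   and those of [chart_inv] on [chart_cod] are meaningful. *)
Record chart (R : realType) (M : topologicalType) (n : nat) := Chart {
  chart_dom : set M;
  chart_map : M -> 'rV[R]_n;
  chart_inv : 'rV[R]_n -> M }.

Definition chart_cod (R : realType) (M : topologicalType) (n : nat)
  (c : chart R M n) : set 'rV[R]_n := chart_map c @` chart_dom c.

Definition is_chart (R : realType) (M : topologicalType) (n : nat)
    (c : chart R M n) : Prop :=
  [/\ open (chart_dom c) /\ open (chart_cod c),
      {in chart_dom c, cancel (chart_map c) (chart_inv c)},
      {in chart_dom c, continuous (chart_map c)} &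
      {in chart_cod c, continuous (chart_inv c)}].

(* The expression of [f] in the charts [c] and [d], and the set on which it is
   meaningful. *)
Definition local_expr (R : realType) (M N : topologicalType) (m n : nat)
    (c : chart R M m) (d : chart R N n) (f : M -> N) : 'rV[R]_m -> 'rV[R]_n :=
  chart_map d \o f \o chart_inv c.

Definition local_dom (R : realType) (M N : topologicalType) (m n : nat)
    (c : chart R M m) (d : chart R N n) (f : M -> N) : set 'rV[R]_m :=
  chart_map c @` (chart_dom c `&` f @^-1` chart_dom d).

Record atlas (R : realType) (M : topologicalType) (n : nat) := Atlas {
  atlas_index : Type;
  atlas_chart :> atlas_index -> chart R M n }.

(* [M], with the smooth structure generated by the atlas [A], is a smooth
   [n]-dimensional manifold without boundary. *)
Definition smooth_manifold (R : realType) (M : topologicalType) (n : nat)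
    (A : atlas R M n) : Prop :=
  [/\ hausdorff_space M /\ @second_countable M,
      forall i, is_chart (A i),
      forall x, exists i, chart_dom (A i) x &
      forall i j, smooth_on (local_dom (A i) (A j) id)
                            (local_expr (A i) (A j) id)].

Definition Ck_map (R : realType) (M N : topologicalType) (m n : nat)
    (A : atlas R M m) (B : atlas R N n) (k : nat) (f : M -> N) : Prop :=
  continuous f /\
  forall i j, Ck_on k (local_dom (A i) (B j) f) (local_expr (A i) (B j) f).

Definition inverse_maps (S T : Type) (f : S -> T) (g : T -> S) : Prop :=
  cancel f g /\ cancel g f.

Definition homeomorphism (M N : topologicalType) (f : M -> N) : Prop :=
  continuous f /\ exists g, inverse_maps f g /\ continuous g.

Definition Ck_diffeo (R : realType) (M N : topologicalType) (m n : nat)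
    (A : atlas R M m) (B : atlas R N n) (k : nat) (f : M -> N) : Prop :=
  Ck_map A B k f /\ exists g, inverse_maps f g /\ Ck_map B A k g.

Definition diffeo (R : realType) (M N : topologicalType) (m n : nat)
    (A : atlas R M m) (B : atlas R N n) (f : M -> N) : Prop :=
  forall k, Ck_diffeo A B k f.

Definition conjugates (T : Type) (psi phi1 phi2 : T -> T) : Prop :=
  exists psi', inverse_maps psi psi' /\ psi \o phi1 \o psi' = phi2.

Definition prod_chart (R : realType) (M N : topologicalType) (m n : nat)
    (c : chart R M m) (d : chart R N n) : chart R (M * N)%type (m + n) :=
  {| chart_dom := chart_dom c `*` chart_dom d;
     chart_map := fun x => row_mx (chart_map c x.1) (chart_map d x.2);
     chart_inv := fun p => (chart_inv c (lsubmx p), chart_inv d (rsubmx p)) |}.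

Definition prod_atlas (R : realType) (M N : topologicalType) (m n : nat)
    (A : atlas R M m) (B : atlas R N n) : atlas R (M * N)%type (m + n) :=
  {| atlas_index := (atlas_index A * atlas_index B)%type;
     atlas_chart := fun ij => prod_chart (A ij.1) (B ij.2) |}.

Section Circle.
Variable R : realType.

Definition circle_rel (x y : R) : bool := x - y \is a Num.int.

Lemma circle_rel_equiv : equiv_class_of circle_rel.
Proof.
split=> [x|x y|y x z]; rewrite /circle_rel.
- by rewrite subrr.
- by rewrite -opprB rpredN.
- by move=> xy yz; rewrite -(subrKA y) rpredD.
Qed.

Canonical circle_equiv := EquivRelPack circle_rel_equiv.

(* R / Z with the quotient topology. *)
Definition circle : topologicalType :=
  quotient_topology {eq_quot circle_equiv}.

Definition circle_proj (x : R) : circle := \pi_{eq_quot circle_equiv} x.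

(* [circle_lift a z] is the representative of [z] in [a - 1/2, a + 1/2[. *)
Definition circle_lift (a : R) (z : circle) : R :=
  let r := repr (z : {eq_quot circle_equiv}) in
  r - (Num.floor (r - a + 2^-1))%:~R.

Definition circle_chart (a : R) : chart R circle 1 :=
  {| chart_dom := circle_proj @` `]a - 2^-1, a + 2^-1[;
     chart_map := fun z => const_mx (circle_lift a z);
     chart_inv := fun p => circle_proj (p 0 0) |}.

Definition circle_atlas : atlas R circle 1 :=
  {| atlas_index := R; atlas_chart := circle_chart |}.

Definition torus2 : topologicalType := (circle * circle)%type.

Definition torus2_atlas : atlas R torus2 2 := prod_atlas circle_atlas circle_atlas.

End Circle.

(* An [n]-form on an [n]-manifold is represented by its coefficient
   [w i] in each chart: on the codomain of the chart [A i] the form is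
   [w i p dp_1 /\ ... /\ dp_n]. *)
Definition top_form (R : realType) (M : topologicalType) (n : nat)
  (A : atlas R M n) : Type := atlas_index A -> 'rV[R]_n -> R.

(* [f] pulls the form [v] back to the form [w]. *)
Definition pulls_back (R : realType) (M N : topologicalType) (n : nat)
    (A : atlas R M n) (B : atlas R N n) (f : M -> N)
    (v : top_form B) (w : top_form A) : Prop :=
  forall i j, {in local_dom (A i) (B j) f, forall p,
    w i p = v j (local_expr (A i) (B j) f p) *
            \det ('J (local_expr (A i) (B j) f) p)}.

Definition volume_form (R : realType) (M : topologicalType) (n : nat)
    (A : atlas R M n) (w : top_form A) : Prop :=
  [/\ forall i, smooth_on (chart_cod (A i))
        (fun p => const_mx (w i p) : 'rV[R]_1),
      forall i, {in chart_cod (A i), forall p, w i p != 0} &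
      pulls_back id w w].

Definition prod_form (R : realType) (M N : topologicalType) (m n : nat)
    (A : atlas R M m) (B : atlas R N n) (v : top_form A) (w : top_form B) :
    top_form (prod_atlas A B) :=
  fun ij p => v ij.1 (lsubmx p) * w ij.2 (rsubmx p).

Definition circle_form (R : realType) : top_form (circle_atlas R) :=
  fun _ _ => 1.

Arguments circle_form : clear implicits.

Definition torus2_form (R : realType) : top_form (torus2_atlas R) :=
  prod_form (circle_form R) (circle_form R).

Arguments torus2_form : clear implicits.

(* The Lebesgue integral over R^n of a nonnegative Borel function, as an
   iterated integral (Tonelli). *)
Fixpoint integral_rV (R : realType) (n : nat) : ('rV[R]_n -> \bar R) -> \bar R :=
  match n with
  | 0 => fun f => f 0
  | n'.+1 => fun f => (\int[lebesgue_measure]_x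
      integral_rV (fun y : 'rV[R]_n' => f (row_mx (x%:M : 'M[R]_1) y)))%E
  end.

Definition borel_set (T : topologicalType) : set (set T) := <<s @open T >>.

(* The measure induced by [w] of a Borel set [S] contained in the domain of the
   chart [A i]. *)
Definition chart_volume (R : realType) (M : topologicalType) (n : nat)
    (A : atlas R M n) (w : top_form A) (i : atlas_index A) (S : set M) : \bar R :=
  integral_rV (fun p => (`|w i p| * \1_(chart_map (A i) @` S) p)%:E).

(* The measure induced by [w] of a Borel set [S]: the supremum of the total
   measure of finitely many disjoint Borel subsets of [S], each of them contained
   in a chart domain.  Countably many such pieces exhaust [S], by second
   countability. *)
Definition volume (R : realType) (M : topologicalType) (n : nat)
    (A : atlas R M n) (w : top_form A) (S : set M) : \bar R :=
  ereal_sup [set s | exists (m : nat) (i : 'I_m -> atlas_index A)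
                            (B : 'I_m -> set M),
    [/\ forall k, borel_set (B k),
        forall k, B k `<=` S `&` chart_dom (A (i k)),
        trivIset [set: 'I_m] B &
        s = (\sum_(k < m) chart_volume w (i k) (B k))%E]].

Definition preserves_volume (R : realType) (M : topologicalType) (n : nat)
    (A : atlas R M n) (w : top_form A) (f : M -> M) : Prop :=
  forall S, borel_set S -> volume w (f @^-1` S) = volume w S.

(* Main.v *)
(* Write T^2 = R^2/Z^2 and, for a 1-periodic g, let skew t g (m, x, y) =
   (m, x + t, y + g x).  With a Liouville number alpha, a lacunary cosine series g
   (called rough below) can be chosen continuous but not Lipschitz at 0, while its
   coboundary f x = g (x + alpha) - g x is smooth.  The volume preserving
   homeomorphism skew 0 g conjugates skew alpha 0 to skew alpha f.

   If a C^1 diffeomorphism psi does so too, then conjugation by psi and conjugation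
   by skew 0 g agree on the translations skew t 0 for all t in Z + N alpha, hence
   for t = 1/2 by density and continuity.  Since g (x + 1/2) = - g x, this says that
   skew (1/2) (-2 g) = psi o skew (1/2) 0 o psi^-1 is differentiable, so that g is
   Lipschitz at 0, a contradiction.  Comparing limits of conjugated translations
   avoids any compactness argument on M.

   For the volume, the charts integrate over M first and over x and y last, so that
   it suffices to use the invariance of Lebesgue measure under y |-> y + g x for
   fixed x, and then under x |-> x + t. *)
From HB Require Import structures.
Require Import Defs.
From mathcomp Require Import all_boot all_order all_algebra generic_quotient.
From mathcomp Require Import all_classical all_reals all_analysis.
From mathcomp Require Import measurable_realfun.
From mathcomp Require Import ring lra.

Set Implicit Arguments.
Unset Strict Implicit.
Unset Printing Implicit Defensive.

Import Order.TTheory GRing.Theory Num.Theory.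
Import numFieldNormedType.Exports.
Local Open Scope classical_set_scope.
Local Open Scope ring_scope.

(** * Calculus of C^k maps in coordinates *)

(** The obstacle is that a conjugacy [psi] may be wild: it need not respect the fibres over the
    first angle, and composing it with any map that commutes with the rotation by [alpha], such as
    one acting on [M] alone, gives another conjugacy. So [psi] cannot be compared with the shear by
    g; only its action by conjugation on limits of powers of the rotation is forced. A conjugated
    translation by t is a skew product by g (x + t) - g x, which may be smooth although g is not; at
    t = 1/2 nothing cancels. The numbers Q_k = 3^((k+1)!), with [alpha] the sum of the 1 / Q_k, are
    also the frequencies of g, up to the factor 2 pi, and have three tasks. The factorial puts Q_k
    alpha within 2 / Q_k^(k+1) of an integer, which beats every fixed power of the frequency and
    makes the coboundary smooth. Oddness makes a half turn reverse the sign of every cosine. The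
    size, at least 4^k, outweighs the amplitudes 2^-k: these are summable, so that g is continuous,
    yet too large at the scale 1 / Q_k for a Lipschitz bound. *)

Lemma near_eq_is_diff (R : numFieldType) (V W : normedModType R)
    (f g : V -> W) (x : V) :
  (\near x, f x = g x) -> differentiable f x ->
  differentiable g x /\ 'd g x = 'd f x :> (V -> W).
Proof.
move=> fg df; have fgx := nbhs_singleton fg.
have dfc := diff_continuous df.
have dg : g \o shift x = cst (g x) + 'd f x +o_ 0 id.
  have := (diff_locallyP x f).1 df => -[_ /eqaddoP fE].
  apply/eqaddoP => e e0; have := fE e e0.
  rewrite -fgx.
  have : \forall y \near (0 : V), f (y + x) = g (y + x).
    by have := near_shift 0 x (fun y => f y = g y); rewrite subr0 => <-.
  by apply: filterS2 => y /= fgy; rewrite !fctE /= fgy.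
have dgE := diff_unique dfc dg.
split=> //; apply/diff_locallyP; rewrite dgE; split=> //.
Qed.

Lemma linear_rV_continuous (R : numFieldType) (m : nat) (V : normedModType R)
    (f : {linear 'rV[R]_m -> V}) : continuous f.
Proof.
have -> : (f : 'rV[R]_m -> V) = fun p => \sum_(i < m) p 0 i *: f (delta_mx 0 i).
  apply/funext => p; rewrite {1}[p]row_sum_delta linear_sum.
  by apply: eq_bigr => i _; rewrite linearZ.
move=> p; elim: (index_enum _) => [|i s IH].
  have -> : (fun q : 'rV[R]_m => \sum_(i <- [::]) q 0 i *: f (delta_mx 0 i)) =
    cst 0 by apply/funext => q; rewrite big_nil.
  exact: cst_continuous.
have -> : (fun q : 'rV[R]_m => \sum_(j <- i :: s) q 0 j *: f (delta_mx 0 j)) =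
    fun q => q 0 i *: f (delta_mx 0 i) + \sum_(j <- s) q 0 j *: f (delta_mx 0 j).
  by apply/funext => q; rewrite big_cons.
have c : {for p, continuous (fun q : 'rV[R]_m => q 0 i *: f (delta_mx 0 i))}.
  by apply: continuousZr_tmp; exact: (@coord_continuous R 1 m 0 i p).
exact: (cvgD c IH).
Qed.

Lemma near_eq_sym (T : topologicalType) (S : Type) (f g : T -> S) (x : T) :
  (\near x, f x = g x) -> \near x, g x = f x.
Proof. by apply: filterS => y ->. Qed.

Arguments linear_rV_continuous {R m V} f.

Section Ck_calculus.
Context {R : realType}.

(** Meant for maps whose formula changes from point to point, as chart expressions on the circle do
    by integers. The induction works because functions equal near [p] are also equal near every
    point close to [p], so their derivatives agree near [p]. *)
Lemma Ck_on_local (m n k : nat) (U : set 'rV[R]_m) (f : 'rV[R]_m -> 'rV[R]_n) :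
  (forall p, U p -> exists (g : 'rV[R]_m -> 'rV[R]_n) (W : set 'rV[R]_m),
    [/\ W p, Ck_on k W g & \near p, f p = g p]) ->
  Ck_on k U f.
Proof.
elim: k f => [|k IH] f loc.
  move=> p /set_mem /loc[g [W [Wp cg fg]]].
  suff : f x @[x --> p] --> g p by rewrite -(nbhs_singleton fg).
  apply: cvg_trans (cg p (mem_set Wp)).
  exact: near_eq_cvg (near_eq_sym fg).
split=> [p /set_mem /loc[g [W [Wp [dg _] fg]]]|v].
  have gf := near_eq_sym fg.
  exact: (near_eq_is_diff gf (dg p (mem_set Wp))).1.
apply: IH => p /loc[g [W [Wp [_ dg] fg]]].
exists (fun x => 'D_v g x), W; split => //.
  exact: dg.
exact: (filterS (fun q fgq => near_eq_derive v fgq) (near_join fg)).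
Qed.

Lemma Ck_on_cst (m n k : nat) (U : set 'rV[R]_m) (c : 'rV[R]_n) :
  Ck_on k U (fun=> c).
Proof.
elim: k c => [|k IH] c; first by move=> p _; exact: cst_continuous.
split=> [p _|v]; first exact: differentiable_cst.
have -> : (fun x => 'D_v (fun=> c) x) = fun=> (0 : 'rV[R]_n).
  by apply/funext => x; rewrite derive_cst.
exact: IH.
Qed.

Lemma Ck_on_linear (m n k : nat) (U : set 'rV[R]_m)
  (l : {linear 'rV[R]_m -> 'rV[R]_n}) : Ck_on k U l.
Proof.
have lc := linear_rV_continuous l.
case: k => [|k]; first by move=> p _; exact: lc.
split=> [p _|v]; first exact: linear_differentiable.
have -> : (fun x => 'D_v l x) = fun=> l v.
  apply/funext => x; rewrite deriveE; last exact: linear_differentiable.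
  by rewrite diff_lin.
exact: Ck_on_cst.
Qed.

Lemma Ck_on_eq_open (m n k : nat) (U : set 'rV[R]_m)
    (f g : 'rV[R]_m -> 'rV[R]_n) :
  open U -> (forall p, U p -> f p = g p) -> Ck_on k U g -> Ck_on k U f.
Proof.
move=> oU fg gk; apply: Ck_on_local => p Up; exists g, U; split => //.
exact: (filterS fg (open_nbhs_nbhs (conj oU Up))).
Qed.

Lemma Ck_onD (m n k : nat) (U : set 'rV[R]_m) (f g : 'rV[R]_m -> 'rV[R]_n) :
  open U -> Ck_on k U f -> Ck_on k U g -> Ck_on k U (f \+ g).
Proof.
move=> oU; elim: k f g => [|k IH] f g /=.
  move=> fk gk p Up; exact: (cvgD (fk p Up) (gk p Up)).
move=> [df fk] [dg gk]; split=> [p Up|v].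
  exact: differentiableD (df p Up) (dg p Up).
apply: (Ck_on_eq_open oU) (IH _ _ (fk v) (gk v)) => p /mem_set Up.
by apply: deriveD; apply: diff_derivable; [exact: df|exact: dg].
Qed.

Lemma Ck_on_post_linear (m n r k : nat) (U : set 'rV[R]_m)
    (f : 'rV[R]_m -> 'rV[R]_n) (l : {linear 'rV[R]_n -> 'rV[R]_r}) :
  open U -> Ck_on k U f -> Ck_on k U (l \o f).
Proof.
have lc := linear_rV_continuous l.
move=> oU; elim: k f => [|k IH] f /=.
  by move=> fk p Up; apply: continuous_comp; [exact: fk|exact: lc].
move=> [df fk]; split=> [p Up|v].
  by apply: differentiable_comp; [exact: df|exact: linear_differentiable].
apply: (Ck_on_eq_open oU) (IH _ (fk v)) => p /mem_set Up /=.
have dl q : differentiable l q by exact: linear_differentiable.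
rewrite !deriveE; [|exact: df|by apply: differentiable_comp; [exact: df|]].
by rewrite diff_comp//; [rewrite /= diff_lin|exact: df].
Qed.

(* The difference quotients of [f \o l] are those of [f], so that the derivatives
   agree everywhere, including where [f] is not differentiable. *)
Lemma Ck_on_pre_linear (m n r k : nat) (U : set 'rV[R]_m)
    (f : 'rV[R]_m -> 'rV[R]_n) (l : {linear 'rV[R]_r -> 'rV[R]_m}) :
  Ck_on k U f -> Ck_on k (l @^-1` U) (f \o l).
Proof.
have lc := linear_rV_continuous l.
elim: k f => [|k IH] f /=.
  by move=> fk p /set_mem Up; apply: continuous_comp; [exact: lc|exact/fk/mem_set].
move=> [df fk]; split=> [p /set_mem Up|v].
  by apply: differentiable_comp; [exact: linear_differentiable|exact/df/mem_set].
have -> : (fun x => 'D_v (f \o l) x) = (fun x => 'D_(l v) f x) \o l.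
  by apply/funext => x; rewrite /derive /= ; under eq_fun do rewrite linearP.
exact: IH.
Qed.

Lemma Ck_on_row_mx (m n r k : nat) (U : set 'rV[R]_m)
    (f : 'rV[R]_m -> 'rV[R]_n) (g : 'rV[R]_m -> 'rV[R]_r) :
  open U -> Ck_on k U f -> Ck_on k U g ->
  Ck_on k U (fun p => row_mx (f p) (g p)).
Proof.
move=> oU fk gk.
have -> : (fun p => row_mx (f p) (g p)) =
    (mulmxr (row_mx 1%:M 0) \o f) \+ (mulmxr (row_mx 0 1%:M) \o g).
  apply/funext => p /=.
  by rewrite !mul_mx_row !mulmx1 !mulmx0 add_row_mx addr0 add0r.
by apply: Ck_onD => //; apply: Ck_on_post_linear.
Qed.

Definition smooth_fun (f : R -> R) := forall k x, derivable f^`(k)%classic x 1.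

(** A directional derivative has the same shape, with [f] replaced by its derivative and [e] by
    [l v *: e]; hence the induction over all [f] and [e]. *)
Lemma Ck_on_smooth_fun (m n k : nat) (U : set 'rV[R]_m) (f : R -> R)
    (l : {linear 'rV[R]_m -> R}) (e : 'rV[R]_n) :
  smooth_fun f -> Ck_on k U (fun p => f (l p) *: e).
Proof.
have lc := linear_rV_continuous l.
elim: k f e => [|k IH] f e sf /=.
  move=> p Up; apply: continuousZr_tmp; apply: continuous_comp; first exact: lc.
  by apply: differentiable_continuous; apply/derivable1_diffP; exact: (sf 0%N).
have df p : differentiable f p by apply/derivable1_diffP; exact: (sf 0%N).
have dl p : differentiable l p by exact: linear_differentiable.
have dfl p : differentiable (f \o l) p by exact: differentiable_comp.
split=> [p _|v].
  by apply: (@differentiableZl _ _ _ (f \o l)).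
have -> : (fun x => 'D_v (fun p => f (l p) *: e) x) =
    fun x => f^`()%classic (l x) *: (l v *: e).
  apply/funext => x; rewrite deriveE; last exact: (@differentiableZl _ _ _ (f \o l)).
  rewrite (@diffZl _ _ _ (f \o l))//= diff_comp//= diff_lin//.
  by rewrite diff1E//= scalerA mulrC.
by apply: IH => j; rewrite -derive1Sn; exact: (sf j.+1).
Qed.

End Ck_calculus.

Lemma smooth_fun_differentiable (R : realType) (f : R -> R) (x : R) :
  smooth_fun f -> differentiable f x.
Proof. by move=> sf; have h := sf 0%N x; exact/derivable1_diffP. Qed.

Lemma smooth_fun_continuous (R : realType) (f : R -> R) :
  smooth_fun f -> continuous f.
Proof.
by move=> sf x; exact/differentiable_continuous/smooth_fun_differentiable.
Qed.

Lemma smooth_fun_cst (R : realType) (c : R) : smooth_fun (fun=> c).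
Proof.
move=> k; elim: k c => [|k IH] c x; first exact: derivable_cst.
rewrite derive1Sn; have -> : (fun _ : R => c)^`()%classic = fun=> 0.
  by apply/funext => y; rewrite derive1_cst.
exact: IH.
Qed.

(** * The circle *)

Lemma continuous_mx (T S : topologicalType) (m n : nat) (f : T -> 'M[S]_(m, n))
    (x : T) :
  (forall i j, {for x, continuous (fun y => f y i j)}) -> {for x, continuous f}.
Proof.
move=> fc A [P Px PA].
have : \forall y \near x, forall i j, P i j (f y i j).
  by apply: filter_forall => i; apply: filter_forall => j; exact: fc (Px i j).
by apply: filterS => y Py; exact: PA.
Qed.

Section circle_topology.
Context {R : realType}.
Implicit Types (x y a : R) (z : circle R).

Lemma eq_circle_proj x y :
  (circle_proj x = circle_proj y) <-> (x - y \is a Num.int).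
Proof. by split=> [/eqmodP|xy]; [|exact/eqmodP]. Qed.

Lemma circle_projD_int x (m : int) : circle_proj (x + m%:~R) = circle_proj x.
Proof. by apply/eq_circle_proj; rewrite addrC addKr intr_int. Qed.

Lemma circle_proj_surj z : exists x, z = circle_proj x.
Proof. by exists (repr z); rewrite /circle_proj reprK. Qed.

Lemma floorD_int x (m : int) : Num.floor (x + m%:~R) = Num.floor x + m.
Proof.
apply/eqP; rewrite floor_eq !intrD lerD2r.
by have := floor_itv x; rewrite intrD => /andP[-> /= h]; rewrite addrAC ltrD2r.
Qed.

(** The arbitrary choice made by [repr] drops out: changing the representative by an integer changes
    the floor by the same integer. *)
Lemma circle_lift_proj a x :
  circle_lift a (circle_proj x) = x - (Num.floor (x - a + 2^-1))%:~R.
Proof.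
rewrite /circle_lift; set r := repr _.
have : circle_proj r = circle_proj x by rewrite /circle_proj reprK.
move/eq_circle_proj/intrP => [m /(canRL (subrK _)) ->].
have -> : m%:~R + x - a + 2^-1 = x - a + 2^-1 + m%:~R by lra.
by rewrite floorD_int intrD; lra.
Qed.

Lemma circle_liftK a : cancel (circle_lift a) (@circle_proj R).
Proof.
move=> z; have [x ->] := circle_proj_surj z.
by rewrite circle_lift_proj -mulrNz circle_projD_int.
Qed.

Lemma circle_lift_itv a z : a - 2^-1 <= circle_lift a z < a + 2^-1.
Proof.
have [x ->] := circle_proj_surj z; rewrite circle_lift_proj.
have := floor_itv (x - a + 2^-1); rewrite intrD; set n := _%:~R => /andP[h1 h2].
by apply/andP; split; lra.
Qed.

Lemma circle_lift_id a x : a - 2^-1 <= x < a + 2^-1 ->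
  circle_lift a (circle_proj x) = x.
Proof.
move=> /andP[h1 h2]; rewrite circle_lift_proj.
suff -> : Num.floor (x - a + 2^-1) = 0 by rewrite subr0.
by apply/eqP; rewrite floor_eq; apply/andP; split; lra.
Qed.

Lemma circle_lift0_proj x : exists m : int, circle_lift 0 (circle_proj x) = x + m%:~R.
Proof.
exists (- Num.floor (x - 0 + 2^-1)); by rewrite circle_lift_proj mulrNz.
Qed.

Lemma circle_domE a z :
  chart_dom (circle_chart a) z <-> a - 2^-1 < circle_lift a z.
Proof.
split=> [[x /=]|h].
  by rewrite in_itv/= => /andP[h1 h2] <-; rewrite circle_lift_id ?ltW.
exists (circle_lift a z); last exact: circle_liftK.
by have /andP[_ h2] := circle_lift_itv a z; rewrite /= in_itv/= h h2.
Qed.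

(** The chart misses exactly one point, the class of [a - 1/2], where the floor in the lift
    jumps. *)
Lemma circle_dom_projE a x :
  chart_dom (circle_chart a) (circle_proj x) <-> x - a + 2^-1 \isn't a Num.int.
Proof.
split.
  move=> /circle_domE; rewrite circle_lift_proj => h; apply/negP => /intrP[m mE].
  move: h; rewrite mE -[m%:~R]add0r floorD_int floor0 add0r.
  have -> : (m%:~R : R) = x - a + 2^-1 by rewrite mE.
  lra.
move=> h; apply/circle_domE; rewrite circle_lift_proj.
have := floor_itv (x - a + 2^-1); rewrite le_eqVlt => /andP[/orP[/eqP e|hr] _]; last lra.
by move: h; rewrite -e intr_int.
Qed.

Lemma circle_dom_center x : chart_dom (circle_chart x) (circle_proj x).
Proof. by exists x => //=; rewrite in_itv/=; lra. Qed.

Lemma circle_codE a p :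
  chart_cod (circle_chart a) p <-> a - 2^-1 < p 0 0 < a + 2^-1.
Proof.
split=> [[z dz <-]|h].
  rewrite /= mxE; move/circle_domE : dz => ->.
  by have /andP[_ ->] := circle_lift_itv a z.
exists (circle_proj (p 0 0)); first by exists (p 0 0).
move: h => /andP[h1 h2].
by apply/rowP => i; rewrite !ord1 mxE circle_lift_id// (ltW h1).
Qed.

Lemma circle_proj_continuous : continuous (@circle_proj R).
Proof. exact: pi_continuous. Qed.

Lemma circle_proj_open (U : set R) : open U -> open (@circle_proj R @` U).
Proof.
move=> oU.
suff : open (@circle_proj R @^-1` (@circle_proj R @` U)) by [].
have -> : @circle_proj R @^-1` (@circle_proj R @` U) =
    \bigcup_(m : int) ((fun x => x + m%:~R) @^-1` U).
  apply/seteqP; split=> x /=.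
    move=> [y Uy /eq_circle_proj/intrP[m mE]]; exists m => //=.
    by rewrite -mE addrC subrK.
  by move=> [m _ /= h]; exists (x + m%:~R) => //; exact: circle_projD_int.
apply: bigcup_open => m _; apply: open_comp => // x _.
by apply: cvgD => //; exact: cvg_cst.
Qed.

Lemma nbhs_circle_proj x (S : set (circle R)) :
  nbhs (circle_proj x) S <-> \forall y \near x, S (circle_proj y).
Proof.
split; first exact: circle_proj_continuous.
move=> /nbhs_interior; rewrite nbhsE => -[U [oU Ux] US].
apply: (@filterS _ _ _ (@circle_proj R @` U)).
  by move=> _ [y Uy <-]; exact: (interior_subset (US y Uy)).
by apply: open_nbhs_nbhs; split; [exact: circle_proj_open|exists x].
Qed.

Lemma floor_near x : x \isn't a Num.int ->
  \forall y \near x, Num.floor y = Num.floor x.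
Proof.
move=> xi; have /andP[h1 h2] := floor_itv x.
have {}h1 : (Num.floor x)%:~R < x.
  by rewrite lt_neqAle h1 andbT; apply: contraNneq xi => <-; rewrite intr_int.
near=> y; apply/eqP; rewrite floor_eq; apply/andP; split.
  by apply/ltW; near: y; exact: lt_nbhsr.
by near: y; exact: lt_nbhsl.
Unshelve. all: by end_near. Qed.

(** Away from the cut the floor is locally constant, so the lift is locally a translation; this is
    why all chart expressions below are explicit up to constants. *)
Lemma circle_lift_near a x : chart_dom (circle_chart a) (circle_proj x) ->
  \forall y \near x, circle_lift a (circle_proj y) =
    y - (Num.floor (x - a + 2^-1))%:~R.
Proof.
move=> /circle_dom_projE /floor_near fl.
have c : (y - a + 2^-1) @[y --> x] --> x - a + 2^-1.
  by apply: cvgD; [apply: cvgB|]; [exact: cvg_id|exact: cvg_cst..].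
have : \forall y \near x, Num.floor (y - a + 2^-1) = Num.floor (x - a + 2^-1).
  exact: c _ fl.
by apply: filterS => y fy; rewrite circle_lift_proj fy.
Qed.

Lemma circle_lift_continuous a z :
  chart_dom (circle_chart a) z -> {for z, continuous (circle_lift a)}.
Proof.
have [x ->] := circle_proj_surj z => dx S.
rewrite /= circle_lift_proj => Sx; apply/nbhs_circle_proj.
have c : (y - (Num.floor (x - a + 2^-1))%:~R) @[y --> x] -->
    x - (Num.floor (x - a + 2^-1))%:~R.
  by apply: cvgB; [exact: cvg_id|exact: cvg_cst].
have := c _ Sx; have := circle_lift_near dx.
by apply: filterS2 => y /= ->.
Qed.

Lemma is_chart_circle a : is_chart (circle_chart a).
Proof.
split.
- split.
    by apply: circle_proj_open; exact: interval_open.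
  have -> : chart_cod (circle_chart a) =
      (fun p : 'rV[R]_1 => p 0 0) @^-1` `]a - 2^-1, a + 2^-1[.
    by apply/seteqP; split=> p; rewrite /= in_itv/= => /circle_codE.
  apply: open_comp; last exact: interval_open.
  by move=> p _; exact: coord_continuous.
- by move=> z _ /=; rewrite mxE circle_liftK.
- move=> z /set_mem dz; apply: continuous_mx => i j.
  rewrite (_ : (fun _ => _) = circle_lift a); first exact: circle_lift_continuous.
  by apply/funext => w; rewrite mxE.
- move=> p _; apply: continuous_comp; first exact: coord_continuous.
  exact: circle_proj_continuous.
Qed.

Lemma circle_hausdorff : hausdorff_space (circle R).
Proof.
move=> z w; have [x ->] := circle_proj_surj z; have [y ->] := circle_proj_surj w.
move=> cl; apply/eq_circle_proj; apply: contrapT => /negP xyi.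
set n := Num.floor (x - y).
have /andP[h1 h2] := floor_itv (x - y).
have {}h1 : n%:~R < x - y.
  by rewrite lt_neqAle h1 andbT; apply: contraNneq xyi => <-; rewrite intr_int.
rewrite -/n intrD in h2.
(* Half the distance from [x - y] to the nearest integer: moving [x] and [y] by less than [e] each
   keeps their difference strictly between [n] and [n + 1]. *)
pose e := Num.min ((x - y) - n%:~R) (n%:~R + 1 - (x - y)) / 2.
have e0 : 0 < e by rewrite divr_gt0// lt_min; apply/andP; split; lra.
have ball_nbhs (u : R) : nbhs (circle_proj u) (@circle_proj R @` ball u e).
  apply/nbhs_circle_proj; have := nbhsx_ballx u e e0.
  by apply: filterS => v uv; exists v.
have [_ [[x' xx'] <-] [y' yy' /esym/eq_circle_proj/intrP[m mE]]] :=
  cl _ _ (ball_nbhs x) (ball_nbhs y).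
move: xx' yy'; rewrite /ball/= !ltr_norml => /andP[b1 b2] /andP[b3 b4].
have e1 : 2 * e <= (x - y) - n%:~R by rewrite /e mulrC divfK// ge_min lexx.
have e2 : 2 * e <= n%:~R + 1 - (x - y) by rewrite /e mulrC divfK// ge_min lexx orbT.
have : n%:~R < (m%:~R : R) by rewrite -mE; lra.
have : (m%:~R : R) < (n + 1)%:~R by rewrite intrD -mE; lra.
by rewrite !ltr_int ltzD1 leNgt => /negbTE ->.
Qed.

End circle_topology.

(** * Skew products over rotations *)

Section skew_product.
Context {R : realType} {M : topologicalType}.
Implicit Types (t x y : R) (g h : R -> R) (m : M) (z : M * torus2 R).

(** The lifts at 0 jump at the cut, so the formula is meant for 1-periodic [g], for which any
    representatives give the same value ([skewE]). *)
Definition skew t g z : M * torus2 R :=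
  let x := circle_lift 0 z.2.1 in
  (z.1, (circle_proj (x + t), circle_proj (circle_lift 0 z.2.2 + g x))).

Lemma periodic_int g x (k : int) : periodic g 1 -> g (x + k%:~R) = g x.
Proof.
move=> pg; case: k => k; first by rewrite -pmulrn periodicn.
by rewrite NegzE mulrNz -pmulrn -[in RHS](subrK (1 *+ k.+1) x) periodicn.
Qed.

Lemma skewE t g m x y : periodic g 1 ->
  skew t g (m, (circle_proj x, circle_proj y)) =
  (m, (circle_proj (x + t), circle_proj (y + g x))).
Proof.
move=> pg; rewrite /skew /=.
have [k ->] := circle_lift0_proj x; have [l ->] := circle_lift0_proj y.
by rewrite addrAC circle_projD_int addrAC circle_projD_int periodic_int.
Qed.

Lemma torus2_surj z : exists m x y, z = (m, (circle_proj x, circle_proj y)).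
Proof.
case: z => m [z w]; have [x ->] := circle_proj_surj z.
by have [y ->] := circle_proj_surj w; exists m, x, y.
Qed.

(** The cocycle rule: every later computation with inverses, powers and conjugates of skew products
    reduces to it. *)
Lemma skewD t g s h z : periodic g 1 -> periodic h 1 ->
  skew s h (skew t g z) = skew (t + s) (fun x => g x + h (x + t)) z.
Proof.
move=> pg ph; have [m [x [y ->]]] := torus2_surj z.
rewrite !skewE ?addrA// => u; congr (_ + _); first exact: pg.
by rewrite addrAC ph.
Qed.

Lemma skew0 z : skew 0 (fun=> 0) z = z.
Proof.
by have [m [x [y ->]]] := torus2_surj z; rewrite skewE // !addr0.
Qed.

Lemma skew_inverse t g : periodic g 1 ->
  inverse_maps (skew t g) (skew (- t) (fun x => - g (x - t))).
Proof.
move=> pg; have pg' : periodic (fun x => - g (x - t)) 1.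
  by move=> x; rewrite addrAC pg.
split=> z; rewrite skewD// ?subrr ?addNr -[RHS]skew0; congr (skew _ _ _);
  by apply/funext => x; rewrite ?addrK ?subrr ?addNr.
Qed.

Lemma nbhs_torus2 m x y (S : set (M * torus2 R)) :
  nbhs (m, (circle_proj x, circle_proj y)) S <->
  \forall p \near (m, (x, y)), S (p.1, (circle_proj p.2.1, circle_proj p.2.2)).
Proof.
split=> [[[A B] /= [mA [[C D] /= [xC yD] CDB]] ABS]|
         [[A B] /= [mA [[C D] /= [xC yD] CDB]] ABS]].
  exists (A, [set p | C (circle_proj p.1) /\ D (circle_proj p.2)]) => /=.
    split=> //; exists (@circle_proj R @^-1` C, @circle_proj R @^-1` D) => //=.
    by split; exact: circle_proj_continuous.
  by move=> p /= [Ap [Cp Dp]]; apply: ABS; split=> //; exact: CDB.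
exists (A, (@circle_proj R @` C) `*` (@circle_proj R @` D)) => /=.
  split=> //; exists (@circle_proj R @` C, @circle_proj R @` D) => //=.
  split; apply/nbhs_circle_proj; [move: xC|move: yD]; apply: filterS => u;
  by exists u.
move=> [p [_ _]] /= [Ap [/= [u Cu <-] [v Dv <-]]].
by apply: (ABS (p, (u, v))); split => //; exact: CDB.
Qed.

Lemma continuous_torus2 (Y : topologicalType) (f : M * torus2 R -> Y) :
  continuous (fun p : M * (R * R) =>
    f (p.1, (circle_proj p.2.1, circle_proj p.2.2))) -> continuous f.
Proof.
move=> fc z; have [m [x [y ->]]] := torus2_surj z => S fS.
exact/nbhs_torus2/(fc (m, (x, y)) S fS).
Qed.

Lemma skew_continuous t g : periodic g 1 -> continuous g ->
  continuous (skew t g).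
Proof.
move=> pg gc; apply: continuous_torus2.
have -> : (fun p : M * (R * R) =>
    skew t g (p.1, (circle_proj p.2.1, circle_proj p.2.2))) =
  fun p => (p.1, (circle_proj (p.2.1 + t), circle_proj (p.2.2 + g p.2.1))).
  by apply/funext => p; rewrite skewE.
move=> p.
have c1 : {for p, continuous (fun p : M * (R * R) => p.2.1)}.
  by apply: continuous_comp; [exact: cvg_snd|exact: cvg_fst].
have c2 : {for p, continuous (fun p : M * (R * R) => p.2.2)}.
  by apply: continuous_comp; [exact: cvg_snd|exact: cvg_snd].
have c3 : {for p, continuous (fun p : M * (R * R) => circle_proj (p.2.1 + t))}.
  apply: continuous_comp; last exact: circle_proj_continuous.
  exact: (cvgD c1 (cvg_cst _)).
have c4 : {for p, continuous (fun p : M * (R * R) => circle_proj (p.2.2 + g p.2.1))}.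
  apply: continuous_comp; last exact: circle_proj_continuous.
  exact: (cvgD c2 (continuous_comp c1 (gc _))).
exact: (cvg_pair cvg_fst (cvg_pair c3 c4)).
Qed.

Lemma skew_homeomorphism t g : periodic g 1 -> continuous g ->
  homeomorphism (skew t g).
Proof.
move=> pg gc; split; first exact: skew_continuous.
eexists; split; first exact: skew_inverse.
apply: skew_continuous => [x|x]; first by rewrite addrAC pg.
apply: continuousN.
by apply: continuous_comp; [exact: (cvgB cvg_id (cvg_cst _))|exact: gc].
Qed.

Lemma skew_orbit_continuous z : continuous (fun t => skew t (fun=> 0) z).
Proof.
have [m [x [y ->]]] := torus2_surj z.
have -> : (fun t => skew t (fun=> 0) (m, (circle_proj x, circle_proj y))) =
    fun t => (m, (circle_proj (x + t), circle_proj y)).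
  by apply/funext => t; rewrite skewE// addr0.
move=> t.
have c : {for t, continuous (fun t => circle_proj (x + t))}.
  apply: continuous_comp; last exact: circle_proj_continuous.
  by apply: cvgD; [exact: cst_continuous|exact: cvg_id].
have cm : {for t, continuous (fun=> m)} by exact: cst_continuous.
have cy : {for t, continuous (fun=> circle_proj y)} by exact: cst_continuous.
exact: (cvg_pair cm (cvg_pair c cy)).
Qed.

End skew_product.
Arguments skew {R M} t g z : simpl never.

(** * Smoothness and Jacobians of skew products *)

Lemma open_local_dom (R : realType) (M N : topologicalType) (m n : nat)
    (c : chart R M m) (d : chart R N n) (f : M -> N) :
  is_chart c -> open (chart_dom d) -> continuous f -> open (local_dom c d f).
Proof.
move=> [[oc occ] cK _ cc] od fc.
have oS : open (chart_dom c `&` f @^-1` chart_dom d).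
  by apply: openI => //; apply: open_comp.
rewrite openE => _ [z zS <-]; have [zc _] := zS.
have codz : chart_cod c (chart_map c z) by exists z.
have n1 : nbhs (chart_map c z) (chart_cod c).
  exact: open_nbhs_nbhs.
have := cc _ (mem_set codz); rewrite /continuous_at cK ?mem_set//.
move=> /(_ _ (open_nbhs_nbhs (conj oS zS))) n2.
apply: filterS2 n1 n2 => _ [w wc <-] /=.
by rewrite cK ?mem_set// => Sw; exists w.
Qed.

Lemma is_chart_prod (R : realType) (M N : topologicalType) (m n : nat)
    (c : chart R M m) (d : chart R N n) :
  is_chart c -> is_chart d -> is_chart (prod_chart c d).
Proof.
move=> [[oc occ] cK cm ci] [[od odc] dK dm di].
have codE : chart_cod (prod_chart c d) =
    (lsubmx @^-1` chart_cod c) `&` (rsubmx @^-1` chart_cod d).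
  apply/seteqP; split=> [_ [[x y] [/= xc yd] <-]|p [/= [x xc xp] [y yd yp]]].
    by rewrite /setI/= row_mxKl row_mxKr; split; [exists x|exists y].
  by exists (x, y) => //=; rewrite xp yp hsubmxK.
split.
- split.
    rewrite openE => -[x y] [/= xc yd].
    exists (chart_dom c, chart_dom d) => //=.
    by split; apply: open_nbhs_nbhs.
  rewrite codE; apply: openI; apply: open_comp => // p _.
    exact: continuous_lsubmx.
  exact: continuous_rsubmx.
- move=> [x y] /set_mem[/= xc yd]; rewrite row_mxKl row_mxKr.
  by rewrite cK ?dK ?mem_set.
- move=> [x y] /set_mem[/= xc yd].
  have c1 : {for (x, y), continuous (chart_map c \o fst : M * N -> 'rV_m)}.
    by apply: continuous_comp; [exact: cvg_fst|exact/cm/mem_set].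
  have c2 : {for (x, y), continuous (chart_map d \o snd : M * N -> 'rV_n)}.
    by apply: continuous_comp; [exact: cvg_snd|exact/dm/mem_set].
  apply: continuous_mx => i j; rewrite (ord1 i); case: (split_ordP j) => k ->.
    have := continuous_comp c1 (@coord_continuous R 1 m 0 k _).
    by congr ({for _, continuous _}); apply/funext => _; apply/funext => -[u v] /=; rewrite row_mxEl.
  have := continuous_comp c2 (@coord_continuous R 1 n 0 k _).
  by congr ({for _, continuous _}); apply/funext => _; apply/funext => -[u v] /=; rewrite row_mxEr.
- rewrite codE => p /set_mem [/= pc pd].
  have c1 : {for p, continuous (chart_inv c \o lsubmx : 'rV_(m + n) -> M)}.
    apply: continuous_comp; first exact: continuous_lsubmx.
    exact/ci/mem_set.
  have c2 : {for p, continuous (chart_inv d \o rsubmx : 'rV_(m + n) -> N)}.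
    apply: continuous_comp; first exact: continuous_rsubmx.
    exact/di/mem_set.
  exact: (cvg_pair c1 c2).
Qed.

Lemma is_diff_row_mx (R : realType) (m n r : nat)
    (f : 'rV[R]_m -> 'rV[R]_n) (g : 'rV[R]_m -> 'rV[R]_r) p :
  differentiable f p -> differentiable g p ->
  differentiable (fun q => row_mx (f q) (g q)) p /\
  forall v, 'd (fun q => row_mx (f q) (g q)) p v = row_mx ('d f p v) ('d g p v).
Proof.
move=> df dg.
pose l1 : {linear 'rV[R]_n -> 'rV[R]_(n + r)} := mulmxr (row_mx 1%:M 0).
pose l2 : {linear 'rV[R]_r -> 'rV[R]_(n + r)} := mulmxr (row_mx 0 1%:M).
have E a b : row_mx a b = l1 a + l2 b.
  by rewrite /= !mul_mx_row !mulmx1 !mulmx0 add_row_mx addr0 add0r.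
have -> : (fun q => row_mx (f q) (g q)) =
(l1 \o f) + (l2 \o g).
  by apply/funext => q; rewrite E.
have c1 := linear_rV_continuous l1; have c2 := linear_rV_continuous l2.
have d1 q : differentiable l1 q by exact: linear_differentiable.
have d2 q : differentiable l2 q by exact: linear_differentiable.
have d1f : differentiable (l1 \o f) p by exact: differentiable_comp.
have d2g : differentiable (l2 \o g) p by exact: differentiable_comp.
split=> [|v]; first exact: differentiableD.
have e1 : 'd (l1 \o f) p = l1 \o 'd f p :> (_ -> _).
  by rewrite diff_comp// diff_lin.
have e2 : 'd (l2 \o g) p = l2 \o 'd g p :> (_ -> _).
  by rewrite diff_comp// diff_lin.
have eD : 'd ((l1 \o f) + (l2 \o g)) p v = 'd (l1 \o f) p v + 'd (l2 \o g) p v.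
  exact: (congr1 (fun h => h v) (diffD d1f d2g)).
have e1v : 'd (l1 \o f) p v = l1 ('d f p v) := congr1 (fun h => h v) e1.
have e2v : 'd (l2 \o g) p v = l2 ('d g p v) := congr1 (fun h => h v) e2.
apply: (etrans eD); apply: (etrans _ (esym (E _ _))).
exact: (congr2 +%R e1v e2v).
Qed.

Lemma near_eq_jacobian (R : realType) (m n : nat)
    (f g : 'rV[R]_m -> 'rV[R]_n) (p : 'rV[R]_m) :
  (\near p, g p = f p) -> differentiable f p -> 'J g p = 'J f p.
Proof.
move=> /near_eq_sym fg df; have [_ dE] := near_eq_is_diff fg df.
exact: (congr1 (@lin1_mx R _ _) dE).
Qed.

Section skew_smooth.
Context {R : realType} (n : nat) {M : topologicalType}.
Variables (A : atlas R M n).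
Hypothesis AM : smooth_manifold A.
Local Notation AT := (prod_atlas A (torus2_atlas R)).
Variables (t : R) (g : R -> R).
Hypotheses (pg : periodic g 1) (sg : smooth_fun g).

Let angle1 (q : 'rV[R]_(n + (1 + 1))) : 'rV[R]_1 := lsubmx (rsubmx q).
Let angle2 (q : 'rV[R]_(n + (1 + 1))) : 'rV[R]_1 := rsubmx (rsubmx q).

(** Normal form of a skew product in charts: [E] stands for a transition map of [M], while [a] and
    [b] absorb [t] and the integers by which the lifts differ. *)
Let skew_expr (E : 'rV[R]_n -> 'rV[R]_n) (a b : R) (q : 'rV[R]_(n + (1 + 1))) :
    'rV[R]_(n + (1 + 1)) :=
  row_mx (E (lsubmx q))
    (row_mx (angle1 q + const_mx a)
            (angle2 q + (g (angle1 q 0 0) *: const_mx 1 + const_mx b))).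

Lemma is_chart_atlas_torus (i : atlas_index AT) : is_chart (AT i).
Proof.
have [_ ch _ _] := AM.
apply: is_chart_prod; first exact: ch.
by apply: is_chart_prod; exact: is_chart_circle.
Qed.

(** The integers subtracted by the target lifts are constant only near [p], so [a] and [b] depend on
    [p] and the identity is local. *)
Lemma local_dom_skew (i j : atlas_index AT) p :
  local_dom (AT i) (AT j) (skew t g) p ->
  local_dom (A i.1) (A j.1) id (lsubmx p) /\
  exists a b, \forall q \near p,
    local_expr (AT i) (AT j) (skew t g) q =
    skew_expr (local_expr (A i.1) (A j.1) id) a b q.
Proof.
case: i j => [i [a1 b1]] [j [a2 b2]] [z [zi zj] pE]; move: pE => <- {p}.
have [m [x0 [y0 zE]]] := torus2_surj z.
have: (chart_dom (A i) `*` (chart_dom (circle_chart a1) `*`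
  chart_dom (circle_chart b1))) z by exact: zi.
have: (chart_dom (A j) `*` (chart_dom (circle_chart a2) `*`
  chart_dom (circle_chart b2))) (skew t g z) by exact: zj.
rewrite {}zE skewE// {zi zj} => -[mj [xj yj]] [mi [xi yi]].
split; first by exists m => //; rewrite /= row_mxKl.
set p := chart_map _ _.
have xE : circle_lift a1 (circle_proj x0) = angle1 p 0 0.
  by rewrite /angle1 /p /= row_mxKr row_mxKl mxE.
have yE : circle_lift b1 (circle_proj y0) = angle2 p 0 0.
  by rewrite /angle2 /p /= row_mxKr row_mxKr mxE.
have [k kE] : exists k : int, angle1 p 0 0 = x0 + k%:~R.
  rewrite -xE circle_lift_proj; eexists; rewrite -mulrNz; reflexivity.
have [l lE] : exists l : int, angle2 p 0 0 = y0 + l%:~R.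
  rewrite -yE circle_lift_proj; eexists; rewrite -mulrNz; reflexivity.
have {}xj : chart_dom (circle_chart a2) (circle_proj (angle1 p 0 0 + t)).
  by rewrite kE addrAC circle_projD_int.
have {}yj : chart_dom (circle_chart b2)
    (circle_proj (angle2 p 0 0 + g (angle1 p 0 0))).
  by rewrite kE lE periodic_int// addrAC circle_projD_int.
have ca1 : {for p, continuous (fun q => angle1 q 0 0)}.
  rewrite (_ : (fun _ => _) = fun q : 'rV[R]_(n + (1 + 1)) => q 0 (rshift n (lshift 1 0))).
    exact: (@coord_continuous R).
  by apply/funext => q; rewrite !mxE.
have ca2 : {for p, continuous (fun q => angle2 q 0 0)}.
  rewrite (_ : (fun _ => _) = fun q : 'rV[R]_(n + (1 + 1)) => q 0 (rshift n (rshift 1 0))).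
    exact: (@coord_continuous R).
  by apply/funext => q; rewrite !mxE.
have cat : {for p, continuous (fun q => angle1 q 0 0 + t)}.
  exact: (cvgD ca1 (cvg_cst _)).
have cag : {for p, continuous (fun q => angle2 q 0 0 + g (angle1 q 0 0))}.
  have cg : {for angle1 p 0 0, continuous g} by exact: smooth_fun_continuous.
  exact: (cvgD ca2 (continuous_comp ca1 cg)).
pose k1 := (Num.floor (angle1 p 0 0 + t - a2 + 2^-1))%:~R : R.
pose k2 := (Num.floor (angle2 p 0 0 + g (angle1 p 0 0) - b2 + 2^-1))%:~R : R.
have nx : \forall q \near p, circle_lift a2 (circle_proj (angle1 q 0 0 + t)) =
    angle1 q 0 0 + t - k1 by exact: cat _ (circle_lift_near xj).
have ny : \forall q \near p,
    circle_lift b2 (circle_proj (angle2 q 0 0 + g (angle1 q 0 0))) =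
    angle2 q 0 0 + g (angle1 q 0 0) - k2 by exact: cag _ (circle_lift_near yj).
exists (t - k1), (- k2); near=> q.
have qx := near nx q; have qy := near ny q.
rewrite -[LHS]/(chart_map
  (prod_chart (A j) (prod_chart (circle_chart a2) (circle_chart b2)))
  (skew t g (chart_inv (A i) (lsubmx q),
    (circle_proj (angle1 q 0 0), circle_proj (angle2 q 0 0))))).
rewrite skewE//= qx// qy// /skew_expr.
have addc (u : 'rV[R]_1) a : (u + const_mx a) 0 0 = u 0 0 + a by rewrite !mxE.
have addg (u : 'rV[R]_1) r b :
    (u + (r *: const_mx 1 + const_mx b)) 0 0 = u 0 0 + (r + b).
  by rewrite !mxE mulr1.
apply: congr2 => //; apply: congr2; apply/rowP => u; rewrite !ord1 [LHS]mxE.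
  by rewrite addc addrA.
by rewrite addg !addrA.
Unshelve. all: by end_near. Qed.

Lemma Ck_on_skew_expr k (W : set 'rV[R]_n) E a b : open W ->
  Ck_on k W E -> Ck_on k (lsubmx @^-1` W) (skew_expr E a b).
Proof.
move=> oW kE.
have oW' : open (lsubmx @^-1` W : set 'rV[R]_(n + (1 + 1))).
  by apply: open_comp => // p _; exact: continuous_lsubmx.
apply: Ck_on_row_mx => //.
  exact: (@Ck_on_pre_linear _ _ _ _ _ W E lsubmx).
apply: Ck_on_row_mx => //.
  apply: Ck_onD => //; last exact: Ck_on_cst.
  exact: (@Ck_on_linear _ _ _ _ _ (lsubmx \o rsubmx)).
apply: Ck_onD => //.
  exact: (@Ck_on_linear _ _ _ _ _ (rsubmx \o rsubmx)).
apply: Ck_onD => //; last exact: Ck_on_cst.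
pose c (v : 'rV[R]_1) := v 0 0.
have cl : linear c by move=> r u v; rewrite /c !mxE.
pose cL : {linear 'rV[R]_1 -> R} := HB.pack c (GRing.isLinear.Build _ _ _ _ _ cl).
exact: (@Ck_on_smooth_fun _ _ _ _ _ g (cL \o (lsubmx \o rsubmx))).
Qed.

Let open_transition i j : open (local_dom (A i) (A j) id).
Proof.
have [_ ch _ _] := AM; apply: open_local_dom; first exact: ch.
  by have [[]] := ch j.
by move=> x; exact: cvg_id.
Qed.

Lemma Ck_map_skew k : Ck_map AT AT k (skew t g).
Proof.
split; first exact: (skew_continuous pg (smooth_fun_continuous sg)).
move=> i j; apply: Ck_on_local => p /local_dom_skew[pd [a [b ab]]].
eexists; eexists; split; [|apply: Ck_on_skew_expr|exact: ab].
- exact: pd.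
- exact: open_transition.
- by have [_ _ _] := AM; exact.
Qed.

Lemma skew_expr_diff (E : 'rV[R]_n -> 'rV[R]_n) (a b : R)
    (p : 'rV[R]_(n + (1 + 1))) : differentiable E (lsubmx p) ->
  differentiable (skew_expr E a b) p /\
  forall v : 'rV[R]_(n + (1 + 1)), 'd (skew_expr E a b) p v =
    row_mx ('d E (lsubmx p) (lsubmx v))
      (row_mx (angle1 v)
        (angle2 v + (g^`()%classic (angle1 p 0 0) * angle1 v 0 0) *: const_mx 1)).
Proof.
move=> dE.
have dlin (m : nat) (l : {linear 'rV[R]_(n + (1 + 1)) -> 'rV[R]_m}) q :
    differentiable l q /\ 'd l q = l :> (_ -> _).
  have lc := linear_rV_continuous l.
  by split; [exact: linear_differentiable|rewrite diff_lin].
have [dl dlE] := dlin _ (lsubmx : {linear _ -> 'rV[R]_n}) p.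
have [d1 d1E] := dlin _ (lsubmx \o rsubmx : {linear _ -> 'rV[R]_1}) p.
have [d2 d2E] := dlin _ (rsubmx \o rsubmx : {linear _ -> 'rV[R]_1}) p.
have dEl : differentiable (E \o lsubmx) p by exact: differentiable_comp.
have dc (c : 'rV[R]_1) : differentiable (cst c) p by exact: differentiable_cst.
have da1 : differentiable (angle1 + cst (const_mx a)) p by exact: differentiableD.
pose c0 (v : 'rV[R]_1) := v 0 0.
have c0l : linear c0 by move=> r u v; rewrite /c0 !mxE.
pose cL : {linear 'rV[R]_1 -> R} := HB.pack c0 (GRing.isLinear.Build _ _ _ _ _ c0l).
pose x1 : {linear 'rV[R]_(n + (1 + 1)) -> R} := cL \o (lsubmx \o rsubmx).
have x1c := linear_rV_continuous x1.
have dx1 : differentiable x1 p by exact: linear_differentiable.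
have dg y : differentiable g y by exact: smooth_fun_differentiable.
have dgx : differentiable (g \o x1) p by exact: differentiable_comp.
have dgz : differentiable (fun q => (g \o x1) q *: (const_mx 1 : 'rV[R]_1)) p.
  exact: differentiableZl.
have dgc : differentiable ((fun q => (g \o x1) q *: (const_mx 1 : 'rV[R]_1)) +
    cst (const_mx b)) p by exact: differentiableD.
have da2 : differentiable (angle2 + ((fun q => (g \o x1) q *: const_mx 1) +
  cst (const_mx b))) p by exact: differentiableD.
have [da da'] := is_diff_row_mx da1 da2.
have [ds ds'] := is_diff_row_mx dEl da.
split=> [|v]; first exact: ds.
pose ev m (h : 'rV[R]_(n + (1 + 1)) -> 'rV[R]_m) := h v.
have e0 : 'd (E \o lsubmx) p v = 'd E (lsubmx p) (lsubmx v).
  apply: (etrans (congr1 (@ev _) (diff_comp dl dE))).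
  by rewrite /ev /=; congr ('d E _ _); exact: (congr1 (@ev _) dlE).
have ec c : 'd (cst c : _ -> 'rV[R]_1) p v = 0.
  exact: (congr1 (@ev _) (diff_cst c p)).
have e1 : 'd (angle1 + cst (const_mx a)) p v = angle1 v.
  apply: (etrans (congr1 (@ev _) (diffD d1 (dc _)))).
  rewrite /ev /= -[RHS]addr0; apply: congr2; last exact: ec.
  exact: (congr1 (@ev _) d1E).
have ex : 'd x1 p v = angle1 v 0 0.
  exact: (congr1 (fun h => h v) (diff_lin p x1c)).
have eg : 'd (g \o x1) p v = g^`()%classic (angle1 p 0 0) * angle1 v 0 0.
  apply: (etrans (congr1 (fun h => h v) (diff_comp dx1 (dg _)))).
  rewrite /= ex (congr1 (fun h => h (angle1 v 0 0)) (diff1E (dg (x1 p)))).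
  by rewrite /= mulrC.
have e3 : 'd (fun q => (g \o x1) q *: (const_mx 1 : 'rV[R]_1)) p v =
    (g^`()%classic (angle1 p 0 0) * angle1 v 0 0) *: const_mx 1.
  apply: (etrans (congr1 (@ev _) (diffZl _ dgx))).
  by rewrite /ev /= -eg.
have e4 : 'd ((fun q => (g \o x1) q *: (const_mx 1 : 'rV[R]_1)) +
    cst (const_mx b)) p v =
    (g^`()%classic (angle1 p 0 0) * angle1 v 0 0) *: const_mx 1 + 0.
  exact: (etrans (congr1 (@ev _) (diffD dgz (dc _))) (congr2 +%R e3 (ec _))).
rewrite addr0 in e4.
have e2 : 'd (angle2 + ((fun q => (g \o x1) q *: (const_mx 1 : 'rV[R]_1)) +
    cst (const_mx b))) p v =
    angle2 v + (g^`()%classic (angle1 p 0 0) * angle1 v 0 0) *: const_mx 1.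
  have e5 : 'd angle2 p v = angle2 v := congr1 (@ev _) d2E.
  exact: (etrans (congr1 (@ev _) (diffD d2 dgc)) (congr2 +%R e5 e4)).
apply: (etrans (ds' v)); apply: congr2; first exact: e0.
by apply: (etrans (da' v)); apply: congr2; [exact: e1|exact: e2].
Qed.

Lemma jacobian_skew_expr (E : 'rV[R]_n -> 'rV[R]_n) (a b : R)
    (p : 'rV[R]_(n + (1 + 1))) : differentiable E (lsubmx p) ->
  \det ('J (skew_expr E a b) p) = \det ('J E (lsubmx p)).
Proof.
move=> dE; have [ds dsE] := skew_expr_diff a b dE.
(* Row vectors multiply from the left, so the derivative of [g] stands above the diagonal. The torus
   block is unipotent and contributes determinant 1. *)
have -> : 'J (skew_expr E a b) p =
    block_mx ('J E (lsubmx p)) 0 0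
      (block_mx 1%:M (const_mx (g^`()%classic (angle1 p 0 0))) 0 1%:M).
  apply/row_matrixP => i; rewrite !rowE.
  move: (delta_mx 0 i : 'rV[R]_(n + (1 + 1))) => v.
  rewrite mul_rV_lin1 dsE -[v in RHS]hsubmxK mul_row_block !mulmx0 addr0 add0r.
  congr (row_mx _ _); first by rewrite mul_rV_lin1.
  rewrite -[rsubmx v](hsubmxK (rsubmx v : 'rV_(1 + 1))) mul_row_block.
  rewrite !mulmx0 addr0 !mulmx1; congr (row_mx _ _); rewrite addrC; congr (_ + _).
  by apply/rowP => j; rewrite !ord1 !mxE big_ord1 !mxE mulr1 mulrC.
by rewrite !det_ublock !det1 !mulr1.
Qed.

(** The torus form has coefficient 1 and the torus block has determinant 1, so what remains is the
    compatibility of [mu] with the transition maps of [M]. *)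
Lemma pulls_back_skew (mu : top_form A) : volume_form mu ->
  pulls_back (skew t g) (prod_form mu (torus2_form R)) (prod_form mu (torus2_form R)).
Proof.
move=> [_ _ pb] i j p /set_mem /[dup] pd /local_dom_skew[pM [a [b ab]]].
have [_ _ _ sm] := AM.
have [dE _] := sm i.1 j.1 1%N.
have dEp := dE _ (mem_set pM).
have [ds _] := skew_expr_diff a b dEp.
have e1 : \det ('J (local_expr (AT i) (AT j) (skew t g)) p) =
    \det ('J (local_expr (A i.1) (A j.1) id) (lsubmx p)).
  exact: (etrans (congr1 determinant (near_eq_jacobian ab ds))
    (jacobian_skew_expr a b dEp)).
pose nu := prod_form mu (torus2_form R).
have nuE k q : nu k q = mu k.1 (lsubmx q).
  by rewrite /nu /prod_form /torus2_form /prod_form /circle_form !mulr1.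
have e2 : nu j (local_expr (AT i) (AT j) (skew t g) p) =
    mu j.1 (local_expr (A i.1) (A j.1) id (lsubmx p)).
  apply: (etrans (congr1 (nu j) (nbhs_singleton ab))).
  by apply: (etrans (nuE _ _)); congr (mu _ _); exact: row_mxKl.
apply: (etrans (nuE _ _)); apply: (etrans (pb _ _ _ (mem_set pM))).
exact: (congr2 *%R (esym e2) (esym e1)).
Qed.

End skew_smooth.

Lemma smooth_fun_opp_shift (R : realType) (g : R -> R) (t : R) :
  smooth_fun g -> smooth_fun (fun x => - g (x - t)).
Proof.
move=> sg.
have dsh (x : R) : is_derive x 1 (fun x => x - t) 1.
  rewrite -[X in is_derive _ _ _ X]subr0.
  exact: is_deriveB.
have dk (k : nat) (x : R) : is_derive x 1 (fun x : R => - g^`(k)%classic (x - t))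
    (- g^`(k.+1)%classic (x - t)).
  apply: is_deriveN.
  have := @is_derive1_comp _ (g^`(k)%classic) (fun x => x - t) x
    (g^`(k.+1)%classic (x - t)) 1.
  rewrite mulr1; apply => //.
  apply: DeriveDef; first exact: sg.
  by rewrite derive1nS derive1E.
have E k : (fun x => - g (x - t))^`(k)%classic = fun x => - g^`(k)%classic (x - t).
  elim: k => // k IH; rewrite derive1nS IH; apply/funext => x.
  by have [_ h] := dk k x; rewrite derive1E h.
by move=> k x; rewrite E; have [] := dk k x.
Qed.

Lemma diffeo_skew (R : realType) (n : nat) (M : topologicalType)
    (A : atlas R M n) (t : R) (g : R -> R) :
  smooth_manifold A -> periodic g 1 -> smooth_fun g ->
  diffeo (prod_atlas A (torus2_atlas R)) (prod_atlas A (torus2_atlas R))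
    (skew t g).
Proof.
move=> AM pg sg k; split; first exact: Ck_map_skew.
eexists; split; first exact: skew_inverse.
apply: Ck_map_skew => //; last exact: smooth_fun_opp_shift.
by move=> x; rewrite addrAC pg.
Qed.

(** * Translations and Lebesgue measure *)

Lemma borel_set_preimage (T S : topologicalType) (f : T -> S) (B : set S) :
  continuous f -> borel_set B -> borel_set (f @^-1` B).
Proof.
move=> fc; apply: (@smallest_sub _ _ _ [set B | borel_set (f @^-1` B)]).
  have [s0 sC sU] := smallest_sigma_algebra setT (@open T).
  split=> /=.
  - by rewrite preimage_set0.
  - by move=> C /sC; rewrite !setTD preimage_setC.
  - by move=> F mF; rewrite preimage_bigcup; exact: sU.
by move=> U oU; apply: sub_sigma_algebra; apply: open_comp.
Qed.

Lemma borel_set_measurable (R : realType) (B : set R) :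
  borel_set B -> measurable B.
Proof.
apply: smallest_sub; first exact: sigma_algebra_measurable.
by move=> U; exact: open_measurable.
Qed.

Section lebesgue_shift.
Context {R : realType}.
Local Notation mu := (@lebesgue_measure R).
Local Open Scope ereal_scope.

Lemma measurable_fun_addr (t : R) :
  measurable_fun [set: R] (fun x : R => x + t)%R.
Proof. by apply: measurable_funD => //; exact: measurable_cst. Qed.

(** The pushforward under the translation agrees with Lebesgue measure on half-open intervals, which
    determine it. *)
Lemma lebesgue_measure_shift (t : R) (A : set R) : measurable A ->
  mu ((fun x => x + t)%R @^-1` A) = mu A.
Proof.
move=> mA.
have mt : @measurable_fun _ _ (measurableTypeR R) (measurableTypeR R) setT
  (fun x => x + t)%R := measurable_fun_addr t.
pose f : {mfun measurableTypeR R >-> measurableTypeR R} :=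
  HB.pack (fun x : R => x + t)%R (isMeasurableFun.Build _ _ _ _ _ mt).
rewrite -[LHS]/(pushforward mu f A).
apply/esym/lebesgue_measure_unique => //= _ [[a b]] _ <-.
rewrite /pushforward (_ : _ @^-1` _ = `](a - t)%R, (b - t)%R]%classic).
  rewrite !lebesgue_measure_itv/= !lte_fin ltrD2r.
  by case: ifP => // _; rewrite -!EFinB; congr EFin; lra.
by apply/seteqP; split=> x; rewrite /= !in_itv/= ltrBlDr lerBrDr.
Qed.

Import HBNNSimple.

(** Argues from the integral as a supremum over simple functions, so it covers inner integrals whose
    measurability in the outer variable is never established. A simple function below the translate
    of [h] moves back to one below [h] with the same integral; the reverse inequality is the same
    one for [- t]. *)
Lemma ge0_integral_shift (t : R) (f : R -> \bar R) : (forall x, 0 <= f x) ->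
  \int[mu]_x f (x + t)%R = \int[mu]_x f x.
Proof.
have main s (h : R -> \bar R) : (forall x, 0 <= h x) ->
    \int[mu]_x h (x + s)%R <= \int[mu]_x h x.
  move=> h0; rewrite !ge0_integralTE//.
  apply: ge_ereal_sup => _ [u /= uh <-]; apply: ereal_sup_ubound.
  have mt : @measurable_fun _ _ (measurableTypeR R) (measurableTypeR R) setT
    (fun x => x - s)%R := measurable_fun_addr (- s)%R.
  pose v x := u (x - s)%R.
  have mv : @measurable_fun _ _ (measurableTypeR R) R setT v.
    exact: (measurableT_comp (@measurable_funPT _ _ _ _ u) mt).
  have fv : finite_set (range v).
    by apply: sub_finite_set (fimfunP u) => _ [x _ <-]; exists (x - s)%R.
  have v0 x : (0 <= v x)%R by rewrite /v.
  pose w : {nnsfun measurableTypeR R >-> R} := HB.pack v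
    (isMeasurableFun.Build _ _ _ _ _ mv) (FiniteImage.Build _ _ _ fv)
    (isNonNegFun.Build _ _ _ v0).
  exists w => /=.
    by move=> x; have := uh (x - s)%R; rewrite subrK.
  rewrite !sintegralET; apply: eq_fsbigr => x _; congr (_ * _).
  rewrite -[RHS](lebesgue_measure_shift (- s)%R)//.
  rewrite -[X in measurable X]setTI.
  exact: (@measurable_funPT _ _ _ _ u) measurableT _ (measurable_set1 x).
move=> f0; apply/eqP; rewrite eq_le main//=.
have := main (- t)%R (fun x => f (x + t)%R) (fun x => f0 _).
by under eq_integral do rewrite subrK.
Qed.

(** The shear slides the interval of the second angle to a position that depends on the first; the
    fixed window [[0, 1[] removes this dependence. *)
Lemma lebesgue_measure_periodic_window (E : set R) (c : R) : measurable E ->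
  (forall (x : R) (k : int), E (x + k%:~R)%R <-> E x) ->
  mu (E `&` `]c, (c + 1)%R[) = mu (E `&` `[0%R, 1%R[).
Proof.
move=> mE EZ.
have shiftE (k : int) a b : mu (E `&` `[a, b[) =
    mu (E `&` `[(a + k%:~R)%R, (b + k%:~R)%R[).
  rewrite -[RHS](lebesgue_measure_shift k%:~R); last exact: measurableI.
  congr (mu _); apply/seteqP; split=> x [Ex] /=.
    by rewrite !in_itv/= lerD2r ltrD2r => ->; split=> //; exact/EZ.
  by rewrite !in_itv/= lerD2r ltrD2r => ->; split=> //; exact/EZ/Ex.
have splitE a b d : (a <= b)%R -> (b <= d)%R ->
    mu (E `&` `[a, d[) = mu (E `&` `[a, b[) + mu (E `&` `[b, d[).
  move=> ab bd; rewrite -measureU; [|exact: measurableI..|].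
    congr (mu _); rewrite -setIUr; congr (_ `&` _).
    by rewrite -itv_bndbnd_setU// bnd_simp.
  apply/seteqP; split=> x //= -[[_]]; rewrite !in_itv/= => /andP[_ xb] [_ /andP[bx _]].
  by have := lt_le_trans xb bx; rewrite ltxx.
(* The two windows differ by the endpoint [c], a null set. *)
have closeE : mu (E `&` `]c, (c + 1)%R[) = mu (E `&` `[c, (c + 1)%R[).
  apply/eqP; rewrite eq_le; apply/andP; split.
    apply: le_measure; rewrite ?inE; [exact: measurableI..|].
    by apply: setIS; apply: subset_itvW.
  rewrite (@le_trans _ _ (mu ([set c] `|` (E `&` `]c, (c + 1)%R[))))//.
    apply: le_measure; rewrite ?inE.
    - exact: measurableI.
    - by apply: measurableU => //; exact: measurableI.
    move=> x [Ex] /=; rewrite !in_itv/= le_eqVlt => /andP[/orP[/eqP ->|cx] xd].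
      by left.
    by right; split=> //; rewrite cx.
  rewrite (le_trans (measureU2 _ _ _))//; first exact: measurableI.
  by rewrite [X in X + _]lebesgue_measure_set1 add0e.
(* The window is moved by [- n], with [n] the floor of [c], and cut at 1. Its part beyond 1, moved
   back by 1, fills [[0, c - n[], the part of [[0, 1[] not yet covered. *)
rewrite closeE (shiftE (- Num.floor c)%R c (c + 1)%R) mulrNz.
have /andP[n1 n2] := floor_itv c; rewrite intrD in n2.
set n := (Num.floor c)%:~R%R in n1 n2 *.
rewrite (splitE _ 1%R); [|lra|lra].
rewrite addeC [in RHS](splitE _ (c - n)%R); [|lra|lra].
congr (_ + _).
by rewrite [RHS](shiftE 1%Z) add0r (_ : 1%:~R = 1%R)// (addrAC c).
Qed.

End lebesgue_shift.

(** * Skew products preserve volume *)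

Lemma borel_setI (T : topologicalType) (B C : set T) :
  borel_set B -> borel_set C -> borel_set (B `&` C).
Proof.
have bC (D : set T) : borel_set D -> borel_set (~` D).
  rewrite -setTD; exact: sigma_algebraCD.
move=> bB bc; rewrite -[_ `&` _]setCK setCI -bigcup2E; apply: (bC).
apply: sigma_algebra_bigcup; case=> [|[|l]] /=; [exact: bC..|].
exact: sigma_algebra0.
Qed.

Lemma image_chart_map (R : realType) (M : topologicalType) (n : nat)
    (c : chart R M n) (S : set M) (q : 'rV[R]_n) :
  is_chart c -> S `<=` chart_dom c ->
  (chart_map c @` S) q <-> chart_cod c q /\ S (chart_inv c q).
Proof.
move=> [_ cK _ _] Sc; split=> [[z Sz <-]|[[z zc <-]]].
  by split; [exists z => //; exact: Sc|rewrite cK//; exact/mem_set/Sc].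
by rewrite cK ?mem_set// => Sz; exists z.
Qed.

Lemma chart_cod_prod (R : realType) (M N : topologicalType) (m n : nat)
    (c : chart R M m) (d : chart R N n) (p : 'rV[R]_m) (q : 'rV[R]_n) :
  chart_cod (prod_chart c d) (row_mx p q) <-> chart_cod c p /\ chart_cod d q.
Proof.
split=> [[[x y] [/= xc yd] /eq_row_mx[<- <-]]|[[x xc <-] [y yd <-]]].
  by split; [exists x|exists y].
by exists (x, y).
Qed.

(** Lets the coordinates of [M] be frozen, so that only the integrals over the torus coordinates are
    compared and no exchange of integrals occurs. *)
Lemma eq_integral_rV_add (R : realType) (n k : nat)
    (F G : 'rV[R]_(n + k) -> \bar R) :
  (forall p : 'rV[R]_n, integral_rV (fun q => F (row_mx p q)) =
                        integral_rV (fun q => G (row_mx p q))) ->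
  integral_rV F = integral_rV G.
Proof.
elim: n F G => [|n IH] F G FG.
  have HE (H : 'rV[R]_(0 + k) -> \bar R) :
      (fun q : 'rV_k => H (row_mx (0 : 'rV_0) q)) = H.
    by apply/funext => q; rewrite row_thin_mx.
  by have := FG 0; rewrite !HE.
rewrite /=; congr integral; apply/funext => x; apply: IH => p.
have HE (H : 'rV[R]_(n.+1 + k) -> \bar R) :
    (fun q : 'rV_k => H (row_mx (row_mx (x%:M : 'M[R]_1) p : 'rV_n.+1) q)) =
    fun q => H (row_mx (x%:M : 'M[R]_1) (row_mx p q)).
  apply/funext => q; apply: (congr1 H).
  exact: (esym (etrans (@row_mxA _ 1 1 n k x%:M p q) (castmx_id _ _))).
by have := FG (row_mx (x%:M : 'M[R]_1) p); rewrite !HE.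
Qed.

Section skew_volume.
Context {R : realType} (n : nat) {M : topologicalType}.
Variables (A : atlas R M n).
Hypothesis AM : smooth_manifold A.
Local Notation AT := (prod_atlas A (torus2_atlas R)).
Local Notation leb := (@lebesgue_measure R).

(** The slice over [m] of the image of [S] in the torus chart centred at [(a, b)], as a subset of
    the plane. *)
Definition slab (a b : R) (S : set (M * torus2 R)) (m : M) : set (R * R) :=
  [set p | [/\ a - 2^-1 < p.1 < a + 2^-1, b - 2^-1 < p.2 < b + 2^-1 &
             S (m, (circle_proj p.1, circle_proj p.2))]].

Lemma measurable_circle_section (S : set (M * torus2 R)) m x :
  borel_set S ->
  measurable [set y : R | S (m, (circle_proj x, circle_proj y))].
Proof.
move=> bS; apply: borel_set_measurable.
apply: (borel_set_preimage (f := fun y => (m, (circle_proj x, circle_proj y)))) => //.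
move=> y.
have cm : {for y, continuous (fun=> m)} by exact: cst_continuous.
have cx : {for y, continuous (fun=> circle_proj x)} by exact: cst_continuous.
exact: (cvg_pair cm (cvg_pair cx (@circle_proj_continuous R y))).
Qed.

Local Open Scope ereal_scope.

(** Centring the left chart at [a - t] makes translation by [t] match the two ranges of the first
    angle exactly, after a shift of the outer integral. In the second angle the ranges differ by
    [g x], and periodicity of the section [F] compensates. *)
Lemma slab_integral_skew (t : R) (g : R -> R) (K a b : R)
    (S : set (M * torus2 R)) m : (0 <= K)%R -> periodic g 1%R -> borel_set S ->
  \int[leb]_x \int[leb]_y
    (K * \1_(slab (a - t) b (skew t g @^-1` S) m) (x, y))%:E =
  \int[leb]_x \int[leb]_y (K * \1_(slab a b S m) (x, y))%:E.
Proof.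
move=> K0 pg bS.
pose H u := \int[leb]_y (K * \1_(slab a b S m) (u, y))%:E.
have H0 u : 0 <= H u.
  by apply: integral_ge0 => y _; rewrite lee_fin mulr_ge0.
rewrite -[RHS](ge0_integral_shift t H0); apply: eq_integral => x _.
have [xt|xt] := pselect (a - 2^-1 < x + t < a + 2^-1)%R; last first.
  rewrite /H !integral0_eq// => y _.
    by rewrite indicE memNset ?mulr0// => -[/= + _ _]; move: xt.
  rewrite indicE memNset ?mulr0// => -[/= h _ _]; apply: xt.
  by move: h; lra.
pose F := [set y : R | S (m, (circle_proj (x + t)%R, circle_proj y))].
have mF : measurable F by exact: measurable_circle_section.
have FZ (y : R) (k : int) : F (y + k%:~R)%R <-> F y.
  by rewrite /F /= circle_projD_int.
have K_indic (c : R) : \int[leb]_y (K * \1_(F `&` `]c, (c + 1)%R[) y)%:E =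
    K%:E * leb (F `&` `[0%R, 1%R[).
  have mI : measurable (F `&` `]c, (c + 1)%R[) by exact: measurableI.
  under eq_integral do rewrite EFinM.
  rewrite ge0_integralZl//=; last exact/measurable_EFinP/measurable_indic.
  rewrite integral_indic// setIT. congr (_ * _).
  exact: lebesgue_measure_periodic_window.
pose c := (b - 2^-1 + g x)%R.
transitivity (\int[leb]_y (K * \1_(F `&` `]c, (c + 1)%R[) (y + g x))%:E).
  apply: eq_integral => y _; congr (_ * _)%:E; rewrite !indicE; congr (_%:R).
  congr (nat_of_bool _); apply/idP/idP => /set_mem h; apply/mem_set; move: h.
    rewrite /slab /= skewE// => -[_ yb Sy]; split; first exact: Sy.
    by rewrite /= in_itv/= /c; move: yb; lra.
  rewrite /slab /= skewE// in_itv/= /c => -[Fy yb]; split; [lra|lra|exact: Fy].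
rewrite (@ge0_integral_shift _ (g x) (fun y => (K * _ y)%:E)); last first.
  by move=> y; rewrite lee_fin mulr_ge0.
rewrite K_indic -(K_indic (b - 2^-1)%R).
apply: eq_integral => y _; congr (_ * _)%:E; rewrite !indicE; congr (_%:R).
congr (nat_of_bool _); apply/idP/idP => /set_mem h; apply/mem_set; move: h.
  rewrite /slab /= in_itv/= => -[Fy yb]; split; [lra|lra|exact: Fy].
move=> [/= _ yb Sy]; split; first exact: Sy.
by rewrite /= in_itv/=; move: yb; lra.
Qed.

Variable mu : top_form A.
Local Notation nu := (prod_form mu (torus2_form R)).

Lemma image_chart_map_slab (i : atlas_index A) (a b : R)
    (S : set (M * torus2 R)) (p : 'rV[R]_n) (x y : R) (z : 'rV[R]_0) :
  S `<=` chart_dom (AT (i, (a, b))) ->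
  (chart_map (AT (i, (a, b))) @` S)
    (row_mx p (row_mx (x%:M : 'M[R]_1) (row_mx (y%:M : 'M[R]_1) z))) <->
  chart_cod (A i) p /\ slab a b S (chart_inv (A i) p) (x, y).
Proof.
move=> Sd; rewrite (image_chart_map _ (is_chart_atlas_torus AM _) Sd).
rewrite (_ : AT _ = prod_chart (A i) (prod_chart (circle_chart a) (circle_chart b)))//.
(* The empty vector [z] is what the iterated integral leaves after its last coordinate. *)
have yE : row_mx (y%:M : 'M[R]_1) z = y%:M.
  apply/rowP => k; have -> : k = lshift 0 ord0 by apply: ord_inj; case: k => -[].
  by rewrite row_mxEl !mxE.
have codE := chart_cod_prod (circle_chart a) (circle_chart b) x%:M
  (row_mx (y%:M : 'M[R]_1) z).
rewrite chart_cod_prod; move: codE; rewrite !circle_codE yE.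
rewrite /= !row_mxKr !row_mxKl !mxE !mulr1n => codE.
split=> [[[pc /codE[xa yb]] Sp]|[pc [xa yb Sp]]]; first by split.
by split=> //; split=> //; exact/codE.
Qed.

(** The preimage of [S] may leave the chart where the second angle is the class of [b - 1/2].
    Intersecting with the chart domain removes that slice, which is null on each line with fixed
    first angle. *)
Lemma chart_volume_skew (t : R) (g : R -> R) i a b
    (S : set (M * torus2 R)) : periodic g 1%R -> borel_set S ->
  S `<=` chart_dom (AT (i, (a, b))) ->
  chart_volume nu (i, ((a - t)%R, b))
    ((skew t g @^-1` S) `&` chart_dom (AT (i, ((a - t)%R, b)))) =
  chart_volume nu (i, (a, b)) S.
Proof.
move=> pg bS Sd; rewrite /chart_volume; apply: eq_integral_rV_add => p /=.
set S' := _ `&` _.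
have S'd : S' `<=` chart_dom (AT (i, ((a - t)%R, b))) by move=> ? [].
have nuE j q : nu j q = mu j.1 (lsubmx q).
  by rewrite /prod_form /torus2_form /prod_form /circle_form !mulr1.
have [pc|pc] := pselect (chart_cod (A i) p).
  pose K := `|mu i p|%R.
  have E c T x y : T `<=` chart_dom (AT (i, (c, b))) ->
    (`|nu (i, (c, b)) (row_mx p (row_mx (x%:M : 'M[R]_1)
        (row_mx (y%:M : 'M[R]_1) 0)))| *
      \1_(chart_map (AT (i, (c, b))) @` T)
        (row_mx p (row_mx (x%:M : 'M[R]_1) (row_mx (y%:M : 'M[R]_1) 0))))%R =
    (K * \1_(slab c b T (chart_inv (A i) p)) (x, y))%R.
    move=> Td; rewrite nuE row_mxKl; congr (_ * _)%R.
    rewrite !indicE; congr (_%:R)%R; congr nat_of_bool.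
    apply/idP/idP => /set_mem h; apply/mem_set.
      by have [_] := (image_chart_map_slab p x y 0 Td).1 h.
    by apply/(image_chart_map_slab p x y 0 Td).
  under eq_integral do under eq_integral do rewrite E//.
  under [RHS]eq_integral do under eq_integral do rewrite E//.
  have K0 : (0 <= K)%R by exact: normr_ge0.
  apply: (etrans _ (slab_integral_skew t a b (chart_inv (A i) p) K0 pg bS)).
  apply: eq_integral => x _; apply: eq_integral => y _; congr (_ * _)%:E.
  rewrite !indicE; congr (_%:R)%R; congr nat_of_bool.
  apply/idP/idP => /set_mem [h1 h2 h3]; apply/mem_set; split => //.
    exact: h3.1.
  split; first exact: h3.
  split; last by split; [exists x; rewrite ?in_itv|exists y; rewrite ?in_itv].
  have [_ /(_ i)[_ cK _ _] _ _] := AM; have [u ud <-] := pc.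
  by rewrite /= cK// mem_set.
have E c T x y : T `<=` chart_dom (AT (i, (c, b))) ->
    (\1_(chart_map (AT (i, (c, b))) @` T)
        (row_mx p (row_mx (x%:M : 'M[R]_1) (row_mx (y%:M : 'M[R]_1) 0))) = 0)%R.
  move=> Td; rewrite indicE memNset// => h; apply: pc.
  by have [] := (image_chart_map_slab p x y 0 Td).1 h.
under eq_integral do under eq_integral do rewrite E// mulr0.
by under [RHS]eq_integral do under eq_integral do rewrite E// mulr0.
Qed.

(** Each finite family of pieces competing for [S] pulls back to one for the preimage, piece by
    piece with the same chart volume. One inequality suffices, since the inverse is again a skew
    product and gives the other. *)
Lemma volume_skew_ge (t : R) (g : R -> R) (S : set (M * torus2 R)) :
  periodic g 1%R -> continuous g -> borel_set S ->
  volume nu S <= volume nu (skew t g @^-1` S).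
Proof.
move=> pg gc bS; apply: ge_ereal_sup => _ [m [i [B [bB BS tB ->]]]].
have skc : continuous (@skew R M t g) by exact: skew_continuous.
pose i' k : atlas_index AT := ((i k).1, (((i k).2.1 - t)%R, (i k).2.2)).
pose B' k := (skew t g @^-1` (B k)) `&` chart_dom (AT (i' k)).
apply: ereal_sup_ubound; exists m, i', B'; split.
- move=> k; apply: borel_setI; first exact: borel_set_preimage.
  by apply: sub_sigma_algebra; have [[]] := is_chart_atlas_torus AM (i' k).
- by move=> k z [/BS[Sz _] zd]; split.
- move=> k l _ _ [z [[kz _] [lz _]]]; apply: tB => //.
  by exists (skew t g z).
- apply: eq_bigr => k _; rewrite /B' /i'; case: (i k) (BS k) => j [a b] BSk.
  by rewrite chart_volume_skew// => z /BSk[].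
Qed.

Lemma preserves_volume_skew (t : R) (g : R -> R) :
  periodic g 1%R -> continuous g -> preserves_volume nu (skew t g).
Proof.
move=> pg gc S bS; apply/eqP; rewrite eq_le volume_skew_ge// andbT.
have pg' : periodic (fun x => - g (x - t))%R 1%R.
  by move=> x; rewrite addrAC pg.
have gc' : continuous (fun x => - g (x - t))%R.
  move=> x; apply: continuousN; apply: continuous_comp; last exact: gc.
  exact: (cvgB cvg_id (cvg_cst _)).
have skc : continuous (@skew R M t g) by exact: skew_continuous.
have := volume_skew_ge (- t) pg' gc' (borel_set_preimage skc bS).
have [_ K] := @skew_inverse R M t g pg.
have -> : skew (- t)%R (fun x => - g (x - t))%R @^-1` (skew t g @^-1` S) = S.
  by apply/seteqP; split=> z; rewrite /preimage/= K.
by [].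
Qed.

End skew_volume.

(** * Trigonometric series *)

Section trigonometric_series.
Context {R : realType}.
Implicit Types (a th w u : nat -> R) (C x y h : R).

Lemma norm_sub_le_of_derive1 (f df : R -> R) (K : R) x y :
  (forall z : R, is_derive z 1 f (df z)) -> (forall z : R, `|df z| <= K) ->
  `|f y - f x| <= K * `|y - x|.
Proof.
move=> fdf dfK; wlog xy : x y / x <= y.
  move=> W; have [/W//|/ltW/W] := leP x y.
  by rewrite distrC (distrC x).
have [c _ ->] : exists2 c, c \in `[x, y] & f y - f x = df c * (y - x).
  apply: MVT_segment => // z.
  apply: continuous_subspaceT => {}z; apply: differentiable_continuous.
  by apply/derivable1_diffP.
by rewrite normrM ler_wpM2r.
Qed.

Lemma cos_lipschitz x y : `|cos y - cos x| <= `|y - x|.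
Proof.
rewrite -[leRHS]mul1r; apply: (norm_sub_le_of_derive1 (df := fun z => - sin z)).
by move=> z; rewrite normrN; exact: sin_max.
Qed.

Lemma sin_lipschitz x y : `|sin y - sin x| <= `|y - x|.
Proof.
rewrite -[leRHS]mul1r; apply: (norm_sub_le_of_derive1 (df := cos)).
by move=> z; exact: cos_max.
Qed.

Lemma cos_taylor1 x h : `|cos (x + h) - cos x + h * sin x| <= h ^+ 2.
Proof.
(* The claim is invariant under changing the signs of both [x] and [h]. *)
wlog h0 : x h / 0 <= h.
  move=> W; have [/W//|/ltW h0] := leP 0 h.
  have := W (- x) (- h); rewrite oppr_ge0 => /(_ h0).
  by rewrite -opprD !cosN sinN mulrNN sqrrN.
rewrite (mulrC h); pose F z := cos (x + z) + sin x * z.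
pose dF z := - sin (x + z) + sin x.
have FdF (z : R) : is_derive z 1 F (dF z).
  apply: is_deriveD; last first.
    have := @is_deriveZ _ _ _ id (sin x) z 1 1 (is_derive_id _ _).
    by rewrite /GRing.scale/= mulr1.
  have := @is_derive1_comp _ cos (fun z => x + z) z (- sin (x + z)) 1.
  rewrite mulr1; apply.
  by rewrite -[X in is_derive _ _ _ X]add0r; exact: is_deriveD.
have [c] : exists2 c, c \in `[0, h] & F h - F 0 = dF c * (h - 0).
  apply: MVT_segment => // z.
  apply: continuous_subspaceT => {}z; apply: differentiable_continuous.
  by apply/derivable1_diffP.
rewrite in_itv/= subr0 => /andP[c0 ch].
rewrite {1 2}/F addr0 mulr0 addr0 addrAC => ->.
rewrite normrM (ger0_norm h0) expr2 ler_wpM2r// /dF addrC.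
rewrite (le_trans (sin_lipschitz _ _))//.
by rewrite opprD addrA subrr sub0r normrN ger0_norm.
Qed.

Lemma series_half_cvg u C : (forall k, `|u k| <= C * 2^-1 ^+ k) ->
  cvgn (series u).
Proof.
move=> uC; apply: normed_cvg.
apply: (series_le_cvg (v_ := geometric C 2^-1)) => [k|k|k|]//=.
  exact: le_trans (uC k).
by apply: is_cvg_geometric_series; rewrite ger0_norm ?invr_ge0// invf_lt1// ltr1n.
Qed.

Lemma series_half_tail u C N : (forall k, `|u k| <= C * 2^-1 ^+ k) ->
  `|limn (series u) - series u N| <= 2 * C * 2^-1 ^+ N.
Proof.
move=> uC; have uc := series_half_cvg uC.
have C0 : 0 <= C by have := le_trans (normr_ge0 _) (uC 0%N); rewrite expr0 mulr1.
have c : (fun n => `|series u n - series u N|) @ \oo -->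
    `|limn (series u) - series u N|.
  by apply: cvg_norm; apply: cvgB => //; exact: cvg_cst.
rewrite -(cvg_lim _ c)//; apply: limr_le; first by apply/cvg_ex; eexists; exact: c.
exists N => // n /= /subnK <-; move: (n - N)%N => {}n.
(* The subtracted term strengthens the bound so that the induction telescopes. *)
suff : `|series u (n + N) - series u N| <=
    2 * C * 2^-1 ^+ N - 2 * C * 2^-1 ^+ (n + N).
  by move/le_trans; apply; rewrite gerBl mulr_ge0// mulr_ge0.
elim: n => [|n IH]; first by rewrite !add0n !subrr normr0.
rewrite addSn seriesSr addrAC (le_trans (ler_normD _ _))//.
have := uC (n + N)%N; move: IH; rewrite exprS.
set z := `|_ - _|; set v := `|u _|; set p := 2^-1 ^+ (n + N); set p' := _ ^+ N.
move=> h1 h2; have -> : 2 * C * (2^-1 * p) = C * p by field.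
lra.
Qed.

(** The phases [th] keep the class closed under differentiation, which adds pi / 2, and let it
    contain the coboundary of [rough]. *)
Definition wave a w th x := limn (series (fun k => a k * cos (w k * x + th k))).

Lemma wave_cvg a w th C x : (forall k, `|a k| <= C * 2^-1 ^+ k) ->
  cvgn (series (fun k => a k * cos (w k * x + th k))).
Proof.
move=> aC; apply: (@series_half_cvg _ C) => k.
rewrite normrM (le_trans _ (aC k))// ler_piMr// cos_max//.
Qed.

Lemma wave_continuous a w th C : (forall k, `|a k| <= C * 2^-1 ^+ k) ->
  continuous (wave a w th).
Proof.
move=> aC x; apply/cvgrPdist_lt => e e0.
have uC y k : `|a k * cos (w k * y + th k)| <= C * 2^-1 ^+ k.
  by rewrite normrM (le_trans _ (aC k))// ler_piMr// cos_max.
have C0 : 0 <= C by have := le_trans (normr_ge0 _) (aC 0%N); rewrite expr0 mulr1.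
(* The two tails and the Lipschitz bound for the partial sum each take a quarter of [e]. *)
have [N Ne] : exists N : nat, 2 * C * 2^-1 ^+ N < e / 4.
  have : (fun n => 2 * C * 2^-1 ^+ n) @ \oo --> (0 : R).
    by apply: cvg_geometric; rewrite ger0_norm// invf_lt1// ltr1n.
  move=> /cvgrPdist_lt /(_ (e / 4)) [|N _ /(_ N (leqnn _))]; first by rewrite divr_gt0.
  rewrite /= sub0r normrN ger0_norm; first by exists N.
  by rewrite !mulr_ge0// exprn_ge0// invr_ge0.
pose S y := series (fun k => a k * cos (w k * y + th k)) N.
pose L := \sum_(0 <= k < N) `|a k| * `|w k|.
have SL y : `|S x - S y| <= L * `|x - y|.
  rewrite /S /series/= -sumrB mulr_suml (le_trans (ler_norm_sum _ _ _))//.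
  apply: ler_sum => k _; rewrite -mulrBr normrM -mulrA ler_wpM2l//.
  by rewrite (le_trans (cos_lipschitz _ _))// opprD addrACA subrr addr0 -mulrBr normrM.
have L0 : 0 <= L by apply: sumr_ge0 => k _; rewrite mulr_ge0.
near=> y.
have h1 := series_half_tail N (uC x); have h2 := series_half_tail N (uC y).
have h3 := SL y.
have h4 : L * `|x - y| <= e / 4.
  rewrite (@le_trans _ _ ((L + 1) * `|x - y|))//; first by rewrite ler_wpM2r// lerDl.
  rewrite -ler_pdivlMl ?ltr_wpDl//.
  apply/ltW; near: y; apply: cvgr_dist_lt => //.
  by rewrite mulr_gt0 ?divr_gt0// invr_gt0 ltr_wpDl.
rewrite /wave; rewrite -/(S x) in h1; rewrite -/(S y) in h2.
move: h1 h2; set X := limn _; set Y := limn _ => h1 h2.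
have -> : X - Y = (X - S x) + (S x - S y) - (Y - S y) by ring.
rewrite (le_lt_trans (ler_normB _ _))//.
rewrite (@le_lt_trans _ _ (`|X - S x| + `|S x - S y| + `|Y - S y|))//.
  by rewrite lerD2r ler_normD.
lra.
Unshelve. all: by end_near. Qed.

Lemma is_derive_of_quadratic_error (f : R -> R) (x d C : R) :
  (forall h, `|f (x + h) - f x - h * d| <= C * h ^+ 2) -> is_derive x 1 f d.
Proof.
move=> fC.
have C0 : 0 <= C.
  by have := le_trans (normr_ge0 _) (fC 1); rewrite expr1n mulr1.
have cv : (fun h => h^-1 *: ((f \o shift x) (h *: 1) - f x)) @ 0^' --> d.
  apply/cvgrPdist_le => e e0; near=> h.
  have h0 : h != 0 by near: h; exact: nbhs_dnbhs_neq.
  rewrite /= [h *: 1]mulr1 (addrC h) [_ *: _]mulrC.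
  have -> : d - (f (x + h) - f x) / h = - ((f (x + h) - f x - h * d) / h) by field.
  rewrite normrN normrM normfV ler_pdivrMr ?normr_gt0//.
  rewrite (le_trans (fC h))// -real_normK ?num_real// expr2 mulrA.
  rewrite ler_wpM2r//.
  rewrite (@le_trans _ _ ((C + 1) * `|h|))//; first by rewrite ler_wpM2r// lerDl.
  rewrite -ler_pdivlMl ?ltr_wpDl//; near: h.
  apply: dnbhs0_le; by rewrite mulr_gt0// invr_gt0 ltr_wpDl.
apply: DeriveDef; first by apply/cvg_ex; exists d.
exact: cvg_lim cv.
Unshelve. all: by end_near. Qed.

(** The factor [2^-1 ^+ k] makes each bound summable at once: exponent [j] controls the series
    differentiated [j] times. *)
Definition rapidly_decreasing a w := forall j : nat, exists C,
  forall k, `|a k| * `|w k| ^+ j <= C * 2^-1 ^+ k.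

Lemma wave_is_derive a w th x : rapidly_decreasing a w ->
  is_derive x 1 (wave a w th)
    (wave (fun k => a k * w k) w (fun k => th k + pi / 2) x).
Proof.
move=> aw; have [C0 aC0] := aw 0%N; have [C1 aC1] := aw 1%N.
have [C2 aC2] := aw 2%N.
have {}aC0 k : `|a k| <= C0 * 2^-1 ^+ k by have := aC0 k; rewrite expr0 mulr1.
have {}aC1 k : `|a k * w k| <= C1 * 2^-1 ^+ k.
  by have := aC1 k; rewrite expr1 -normrM.
apply: (@is_derive_of_quadratic_error _ _ _ (2 * C2)) => h.
rewrite /wave.
set u1 := fun k => a k * cos (w k * (x + h) + th k).
set u2 := fun k => a k * cos (w k * x + th k).
set u3 := fun k => a k * w k * cos _.
have c1 : cvgn (series u1) by exact: wave_cvg aC0.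
have c2 : cvgn (series u2) by exact: wave_cvg aC0.
have c3 : cvgn (series u3) by exact: wave_cvg aC1.
have -> : limn (series u1) - limn (series u2) - h * limn (series u3) =
    limn (series (u1 - u2 - h *: u3)).
  rewrite lim_seriesB; [|exact: is_cvg_seriesB|exact: is_cvg_seriesZ].
  by rewrite lim_seriesB// lim_seriesZ.
(* Each term is a first-order Taylor error, at most [|a k| * (w k * h) ^+ 2]; the bound with
   exponent 2 makes these summable, uniformly in [x]. *)
have uC k : `|(u1 - u2 - h *: u3) k| <= (C2 * h ^+ 2) * 2^-1 ^+ k.
  rewrite -[(_ - _ - _) k]/(u1 k - u2 k - h * u3 k) /u1 /u2 /u3.
  set t := w k * x + th k.
  have -> : w k * (x + h) + th k = t + w k * h by rewrite /t; ring.
  rewrite addrA -/t cosDpihalf.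
  have -> : a k * cos (t + w k * h) - a k * cos t - h * (a k * w k * - sin t) =
    a k * (cos (t + w k * h) - cos t + w k * h * sin t) by ring.
  rewrite normrM (le_trans (ler_wpM2l _ (cos_taylor1 _ _)))//.
  have := ler_wpM2r (sqr_ge0 h) (aC2 k).
  rewrite real_normK ?num_real// (mulrAC C2).
  by have -> : `|a k| * (w k * h) ^+ 2 = `|a k| * w k ^+ 2 * h ^+ 2 by ring.
have := series_half_tail 0 uC.
by rewrite /series/= big_geq// subr0 expr0 mulr1 mulrA.
Qed.

Lemma rapidly_decreasing_mul a w :
  rapidly_decreasing a w -> rapidly_decreasing (fun k => a k * w k) w.
Proof.
move=> aw j; have [C aC] := aw j.+1; exists C => k.
by rewrite normrM -mulrA -exprS.
Qed.

Lemma wave_smooth a w th : rapidly_decreasing a w -> smooth_fun (wave a w th).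
Proof.
move=> aw k; elim: k a th aw => [|k IH] a th aw x.
  by have [] := wave_is_derive th x aw.
rewrite derive1Sn.
have -> : (wave a w th)^`()%classic =
    wave (fun k => a k * w k) w (fun k => th k + pi / 2).
  by apply/funext => y; have [_ h] := wave_is_derive th y aw; rewrite derive1E.
exact/IH/rapidly_decreasing_mul.
Qed.

End trigonometric_series.

(** * A Liouville number and its coboundaries *)

Definition liouville_den (k : nat) : nat := 3 ^ (k.+1)`!.

Lemma liouville_denS k : liouville_den k.+1 = (liouville_den k ^ k.+2)%N.
Proof. by rewrite /liouville_den factS mulnC expnM. Qed.

Lemma liouville_den_gt0 k : (0 < liouville_den k)%N.
Proof. by rewrite expn_gt0. Qed.

Lemma liouville_den_ge3 k : (3 <= liouville_den k)%N.
Proof. by rewrite -[X in (X <= _)%N]expn1 leq_exp2l// fact_gt0. Qed.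

Lemma odd_liouville_den k : odd (liouville_den k).
Proof. by rewrite oddX orbT. Qed.

Lemma dvdn_liouville_den j k : (j <= k)%N -> (liouville_den j %| liouville_den k)%N.
Proof. by move=> jk; apply: dvdn_exp2l; exact: leq_fact. Qed.

Lemma exp4_le_liouville_den k : (4 ^ k <= liouville_den k)%N.
Proof.
elim: k => // -[//|k] IH; rewrite liouville_denS expnS.
have d4 : (4 <= liouville_den k.+1)%N.
  rewrite (@leq_trans (3 ^ 2))// leq_exp2l// factS.
  by rewrite (leq_trans _ (leq_pmulr _ (fact_gt0 _))).
rewrite (@leq_trans (liouville_den k.+1 ^ 2))//.
  by rewrite -mulnn leq_mul.
by rewrite leq_pexp2l// liouville_den_gt0.
Qed.

Section liouville_number.
Context {R : realType}.
Local Notation q k := (liouville_den k).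
Local Notation Q k := ((liouville_den k)%:R : R).

Definition liouville_sum (n : nat) : R := \sum_(0 <= j < n) (Q j)^-1.

Definition liouville_number : R := sup (range liouville_sum).
Local Notation alpha := liouville_number.

Let Q_gt0 k : 0 < Q k.
Proof. by rewrite ltr0n liouville_den_gt0. Qed.

Let QS k : Q k.+1 = Q k ^+ k.+2.
Proof. by rewrite liouville_denS natrX. Qed.

Let sumS n : liouville_sum n.+1 = liouville_sum n + (Q n)^-1.
Proof. by rewrite /liouville_sum big_nat_recr. Qed.

(** The upper ends of the intervals from [liouville_sum n] to [liouville_sum n + 2 / Q n] decrease,
    so the intervals are nested and trap [alpha]. *)
Let sum_ub n : liouville_sum n.+1 + 2 / Q n.+1 <= liouville_sum n + 2 / Q n.
Proof.
rewrite sumS -addrA lerD2l.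
have h : 2 / Q n.+1 <= (Q n)^-1.
  rewrite ler_pdivrMr// ler_pdivlMl// -natrM ler_nat liouville_denS expnS.
  rewrite mulnC leq_mul//.
  rewrite (@leq_trans (liouville_den n))//; first exact: ltnW (liouville_den_ge3 n).
  by rewrite -[X in (X <= _)%N]expn1 leq_pexp2l// liouville_den_gt0.
by lra.
Qed.

Let sum_le n m : liouville_sum m <= liouville_sum n + 2 / Q n.
Proof.
have inc i j : (i <= j)%N -> liouville_sum i <= liouville_sum j.
  move=> /subnK <-; elim: (j - i)%N => // l IH; rewrite addSn sumS.
  by rewrite (le_trans IH)// lerDl invr_ge0 ltW.
have dec i j : (i <= j)%N -> liouville_sum j + 2 / Q j <= liouville_sum i + 2 / Q i.
  by move=> /subnK <-; elim: (j - i)%N => // l IH; rewrite addSn (le_trans (sum_ub _)).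
have pos i : 0 <= 2 / Q i by rewrite divr_ge0// ltW.
have [/inc h|/ltnW/dec] := leqP m n; first by rewrite (le_trans h)// lerDl.
by apply: le_trans; rewrite lerDl.
Qed.

Let sum_le_alpha n : liouville_sum n <= alpha.
Proof.
apply: ub_le_sup; last by exists n.
by exists (liouville_sum 0 + 2 / Q 0) => _ [m _ <-]; exact: sum_le.
Qed.

Let alpha_le n : alpha <= liouville_sum n + 2 / Q n.
Proof.
apply: ge_sup; first by exists (liouville_sum 0); exists 0%N.
by move=> _ [m _ <-]; exact: sum_le.
Qed.

Definition liouville_gap k : R := Q k * (alpha - liouville_sum k.+1).
Local Notation delta := liouville_gap.

Lemma liouville_gap_gt0 k : 0 < delta k.
Proof.
rewrite mulr_gt0// subr_gt0 (lt_le_trans _ (sum_le_alpha k.+2))//.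
by rewrite [ltRHS]sumS ltrDl invr_gt0.
Qed.

(** The tail after the term of index [k] is at most [2 / Q k.+1], and [Q k.+1] is the power [k.+2]
    of [Q k]; one factor cancels. *)
Lemma liouville_gap_le k : delta k <= 2 / Q k ^+ k.+1.
Proof.
have := alpha_le k.+1; rewrite -lerBlDl => h.
rewrite /delta (le_trans (ler_wpM2l (ltW (Q_gt0 k)) h))//.
rewrite QS [Q k ^+ k.+2]exprS; have := exprn_gt0 k.+1 (Q_gt0 k).
move: (Q k ^+ k.+1) (Q_gt0 k) => p; move: (Q k) => r r0 p0.
suff -> : r * (2 / (r * p)) = 2 / p by [].
by field; rewrite !gt_eqF.
Qed.

(** Each earlier denominator divides [Q k], so [Q k] times the partial sum is an integer. *)
Lemma liouville_numberE k : exists N : nat, Q k * alpha = delta k + N%:R.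
Proof.
exists (\sum_(0 <= j < k.+1) (q k %/ q j))%N.
rewrite /delta mulrBr natr_sum /liouville_sum mulr_sumr.
rewrite -addrA (_ : - _ + _ = 0) ?addr0//; apply/eqP; rewrite addrC subr_eq0.
apply/eqP; apply: eq_big_nat => j /andP[_ jk].
by rewrite natf_div ?dvdn_liouville_den.
Qed.

End liouville_number.
Arguments liouville_number : clear implicits.

Section rough_transfer_function.
Context {R : realType}.
Local Notation Q k := ((liouville_den k)%:R : R).
Local Notation alpha := (liouville_number R).

Definition liouville_freq k : R := 2 * pi * Q k.

Definition rough : R -> R :=
  wave (fun k => 2^-1 ^+ k) liouville_freq (fun=> 0).

Let half_bound (k : nat) : `|2^-1 ^+ k : R| <= 1 * 2^-1 ^+ k.
Proof. by rewrite mul1r ger0_norm ?exprn_ge0 ?invr_ge0. Qed.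

Let half_ge0 (k : nat) : 0 <= 2^-1 ^+ k :> R.
Proof. by rewrite exprn_ge0 ?invr_ge0. Qed.

Lemma rough_continuous : continuous rough.
Proof. exact: (@wave_continuous _ _ _ _ 1). Qed.

Lemma rough_periodic : periodic rough 1.
Proof.
move=> x; rewrite /rough /wave; congr (limn (series _)).
apply/funext => k; congr (_ * _).
rewrite -[RHS](periodicn (@cosD2pi R) (liouville_den k)); congr (cos _).
by rewrite /liouville_freq -[in RHS]mulr_natr -(mulr_natr pi 2); ring.
Qed.

Lemma rough_half_period x : rough (x + 2^-1) = - rough x.
Proof.
rewrite /rough /wave -lim_seriesN; last exact: (@wave_cvg _ _ _ _ 1).
congr (limn (series _)); apply/funext => k.
rewrite -[RHS]/(- (2^-1 ^+ k * cos (liouville_freq k * x + 0))) -mulrN.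
congr (_ * _); transitivity (cos (liouville_freq k * x + 0 + pi *+ liouville_den k)).
  by congr (cos _); rewrite /liouville_freq -mulr_natr; field.
by rewrite (alternatingn (@cosDpi R)) -signr_odd odd_liouville_den expr1 mulN1r.
Qed.

(* Modulo 1, [liouville_den k * liouville_number R] is [liouville_gap k], so that
   each summand of the coboundary is again a cosine, of tiny amplitude. *)
Lemma rough_coboundaryE :
  (fun x => rough (x + alpha) - rough x) =
  wave (fun k => 2^-1 ^+ k * (2 * sin (pi * liouville_gap k))) liouville_freq
       (fun k => pi * liouville_gap k + pi / 2).
Proof.
apply/funext => x; rewrite /rough /wave.
set u := fun k => _ * cos (liouville_freq k * (x + alpha) + 0).
set v := fun k => _ * cos (liouville_freq k * x + 0).
have uc : cvgn (series u) by exact: (@wave_cvg _ _ _ _ 1).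
have vc : cvgn (series v) by exact: (@wave_cvg _ _ _ _ 1).
rewrite -lim_seriesB//; congr (limn (series _)); apply/funext => k.
rewrite -[LHS]/(u k - v k) /u /v -mulrBr -[RHS]mulrA; congr (_ * _).
have [N NE] := @liouville_numberE R k.
set s := liouville_freq k * x; set d := pi * liouville_gap k.
have -> : liouville_freq k * (x + alpha) + 0 = s + d + d + (pi *+ 2) *+ N.
  rewrite addr0 mulrDr -/s -addrA -addrA; congr (_ + _).
  rewrite /liouville_freq -mulrA NE /d -(mulr_natr _ N) -(mulr_natr pi 2); ring.
rewrite (periodicn (@cosD2pi R)) addr0 addrA cosDpihalf.
(* Expanding both cosines about the midpoint [s + d] leaves [-2 * sin d * sin (s + d)]. *)
have -> : cos s = cos (s + d - d) by rewrite addrK.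
by rewrite cosD cosB; ring.
Qed.

Lemma rough_coboundary_rapidly_decreasing :
  rapidly_decreasing (fun k => 2^-1 ^+ k * (2 * sin (pi * liouville_gap k)))
    liouville_freq.
Proof.
move=> j; exists ((2 * pi) ^+ j.+1 * (2 * Q j ^+ j)) => k.
have Q1 i : 1 <= Q i by rewrite ler1n liouville_den_gt0.
have Q0 i : 0 <= Q i by rewrite ler0n.
have pi0 : 0 <= 2 * pi :> R by rewrite mulr_ge0// pi_ge0.
have d0 := ltW (@liouville_gap_gt0 R k).
have sind : `|sin (pi * liouville_gap k)| <= pi * liouville_gap k :> R.
  have := @sin_lipschitz R 0 (pi * liouville_gap k); rewrite sin0 !subr0.
  by rewrite [X in _ <= X -> _]ger0_norm// mulr_ge0// pi_ge0.
(* Once [j <= k.+1], the gap bound absorbs the power of [Q k] and leaves 2. For the finitely many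
   smaller [k] the gap is at most 2 and [Q k <= Q j], whence the constant [2 * Q j ^+ j]. *)
have dQ : liouville_gap k * Q k ^+ j <= 2 * Q j ^+ j.
  have dk := @liouville_gap_le R k.
  have [jk|kj] := leqP j k.+1.
    rewrite (@le_trans _ _ (2 / Q k ^+ k.+1 * Q k ^+ k.+1))//.
      rewrite ler_pM// ?exprn_ge0//; first exact: ler_weXn2l.
    rewrite divfK ?expf_neq0 ?gt_eqF ?(lt_le_trans ltr01)//.
    by rewrite ler_peMr// exprn_ege1.
  rewrite ler_pM ?exprn_ge0//.
    rewrite (le_trans dk)// ler_pdivrMr ?exprn_gt0 ?(lt_le_trans ltr01)//.
    by rewrite ler_peMr// exprn_ege1.
  rewrite lerXn2r ?nnegrE// ler_nat dvdn_leq ?liouville_den_gt0//.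
  by rewrite dvdn_liouville_den// ltnW// ltnW.
rewrite normrM (ger0_norm (half_ge0 k)) normrM (ger0_norm (ler0n _ 2)).
rewrite (@ger0_norm _ (liouville_freq k)); last by rewrite mulr_ge0.
rewrite -[leLHS]mulrA [leLHS]mulrC ler_wpM2r// /liouville_freq exprMn.
rewrite (@le_trans _ _ (2 * (pi * liouville_gap k) * ((2 * pi) ^+ j * Q k ^+ j)))//.
  by rewrite ler_wpM2r// ?mulr_ge0// ?exprn_ge0// ler_wpM2l.
have -> : 2 * (pi * liouville_gap k) * ((2 * pi) ^+ j * Q k ^+ j) =
    (2 * pi) ^+ j.+1 * (liouville_gap k * Q k ^+ j) by rewrite exprS; ring.
by rewrite ler_wpM2l// exprn_ge0.
Qed.

Lemma rough_coboundary_smooth : smooth_fun (fun x => rough (x + alpha) - rough x).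
Proof.
rewrite rough_coboundaryE; exact/wave_smooth/rough_coboundary_rapidly_decreasing.
Qed.

(** At this point the cosine of index [k] has argument pi and drops by 2. No other term can offset
    this, since every cosine is maximal at 0. *)
Lemma rough_drop k : 2 * 2^-1 ^+ k <= rough 0 - rough (2 * Q k)^-1.
Proof.
rewrite /rough /wave.
set u := fun k => _ * cos (liouville_freq k * 0 + 0).
set v := fun k => _ * cos (liouville_freq k * _ + 0).
have uc : cvgn (series u) by exact: (@wave_cvg _ _ _ _ 1).
have vc : cvgn (series v) by exact: (@wave_cvg _ _ _ _ 1).
rewrite -lim_seriesB//.
have uvE j : (u - v) j = 2^-1 ^+ j * (1 - cos (liouville_freq j / (2 * Q k))).
  by rewrite -[LHS]/(u j - v j) /u /v !addr0 mulr0 cos0 mulrBr.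
have uv0 j : 0 <= (u - v) j by rewrite uvE mulr_ge0// subr_ge0 cos_le1.
have uvk : (u - v) k = 2 * 2^-1 ^+ k.
  rewrite uvE /liouville_freq.
  have -> : 2 * pi * Q k / (2 * Q k) = pi.
    by field; rewrite pnatr_eq0 -lt0n liouville_den_gt0.
  by rewrite cospi opprK mulrC.
have uvc : cvgn (series (u - v)) by exact: is_cvg_seriesB.
rewrite -uvk (le_trans _ (nondecreasing_cvgn_le _ uvc k.+1))//.
  by rewrite seriesSr lerDr sumr_ge0.
by apply: nondecreasing_series => j _ _.
Qed.

Lemma rough_not_lipschitz_at0 (L e : R) : 0 < e ->
  ~ (forall x, `|x| < e -> `|rough x - rough 0| <= L * `|x|).
Proof.
move=> e0 H.
have [k kL] : exists k : nat, Num.max `|L| e^-1 < k%:R.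
  by exists (Num.bound (Num.max `|L| e^-1)); apply: archi_boundP; rewrite le_max normr_ge0.
move: kL; rewrite gt_max => /andP[kL ke].
have Q0 : 0 < Q k by rewrite ltr0n liouville_den_gt0.
have x0 : 0 < (2 * Q k)^-1 by rewrite invr_gt0 mulr_gt0.
(* As [Q k] is at least [4 ^ k], the drop divided by the distance is at least [4 * k], while [k] was
   chosen above [|L|]. *)
have k4 : k%:R * 2 ^+ k <= Q k.
  rewrite -natrX -natrM ler_nat (leq_trans _ (exp4_le_liouville_den k))//.
  by rewrite -[4%N]/(2 * 2)%N expnMn leq_mul// ltnW// ltn_expl.
have k1 : 1 <= 2 ^+ k :> R by rewrite exprn_ege1// ler1n.
have kQ : k%:R <= Q k by rewrite (le_trans _ k4)// ler_peMr.
have := H (2 * Q k)^-1; rewrite gtr0_norm// => /(_ _)/wrap[].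
  rewrite -[ltRHS]invrK ltf_pV2 ?posrE ?mulr_gt0 ?invr_gt0//.
  by rewrite (lt_le_trans ke)// (le_trans kQ)// ler_peMl ?ler1n// ltW.
rewrite distrC => /(le_trans (ler_norm _)).
move=> /(le_trans (rough_drop k)) h.
have {h} : 2 * 2^-1 ^+ k <= `|L| / (2 * Q k).
  by rewrite (le_trans h)// ler_wpM2r ?(ltW x0)// ler_norm.
rewrite ler_pdivlMr ?mulr_gt0//.
have -> : 2 * 2^-1 ^+ k * (2 * Q k) = 4 * (Q k / 2 ^+ k) by rewrite exprVn; ring.
have : k%:R <= Q k / 2 ^+ k by rewrite ler_pdivlMr// (lt_le_trans ltr01).
have : 0 <= k%:R :> R by [].
by move: (Q k / 2 ^+ k) => z; lra.
Qed.

End rough_transfer_function.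

(** * Absence of smooth conjugacies *)

Lemma hausdorff_prod (T S : topologicalType) :
  hausdorff_space T -> hausdorff_space S -> hausdorff_space (T * S)%type.
Proof.
move=> hT hS [x y] [x' y'] cl; congr (_, _).
  apply: hT => U V Ux Vx.
  have Up : nbhs (x, y) (U `*` setT) by exists (U, setT) => //; split=> //; exact: filterT.
  have Vp : nbhs (x', y') (V `*` setT) by exists (V, setT) => //; split=> //; exact: filterT.
  by have [[u v] [[Uu _] [Vu _]]] := cl _ _ Up Vp; exists u.
apply: hS => U V Uy Vy.
have Up : nbhs (x, y) (setT `*` U) by exists (setT, U) => //; split=> //; exact: filterT.
have Vp : nbhs (x', y') (setT `*` V) by exists (setT, V) => //; split=> //; exact: filterT.
by have [[u v] [[_ Uv] [_ Vv]]] := cl _ _ Up Vp; exists v.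
Qed.

Lemma continuous_eq_limit_point (T S : topologicalType) (f g : T -> S)
    (D : set T) (x : T) : hausdorff_space S -> continuous f -> continuous g ->
  (forall y, D y -> f y = g y) -> closure D x -> f x = g x.
Proof.
move=> hS fc gc fg Dx; apply: hS => U V Uf Vg.
have Ux : nbhs x (f @^-1` U) by exact: fc.
have Vx : nbhs x (g @^-1` V) by exact: gc.
have [y [Dy [Uy Vy]]] := Dx _ (filterI Ux Vx).
by exists (f y); split => //; rewrite fg.
Qed.

(** The chain rule in charts: the middle chart cancels only where [f] lands in its domain, which
    continuity ensures near the point. *)
Lemma differentiable_local_expr_comp (R : realType) (M N P : topologicalType)
    (m n r : nat) (c : chart R M m) (d : chart R N n) (e : chart R P r)
    (f : M -> N) (g : N -> P) (z : M) :
  is_chart c -> is_chart d -> chart_dom c z -> chart_dom d (f z) ->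
  continuous f ->
  differentiable (local_expr c d f) (chart_map c z) ->
  differentiable (local_expr d e g) (chart_map d (f z)) ->
  differentiable (local_expr c e (g \o f)) (chart_map c z).
Proof.
move=> [_ cK _ ci] [[od _] dK _ _] zc zd fc df dg.
have cz : chart_inv c (chart_map c z) = z by rewrite cK ?mem_set.
have {}dg : differentiable (local_expr d e g) (local_expr c d f (chart_map c z)).
  suff -> : local_expr c d f (chart_map c z) = chart_map d (f z) by [].
  by rewrite /local_expr /= cz.
have near_d : \forall p \near chart_map c z, chart_dom d (f (chart_inv c p)).
  have cont : {for chart_map c z, continuous (f \o chart_inv c)}.
    apply: continuous_comp; last exact: fc.
    by apply: ci; apply: mem_set; exists z.
  by apply: cont; apply: open_nbhs_nbhs; split=> //=; rewrite cz.
apply: (near_eq_is_diff _ (differentiable_comp df dg)).1.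
apply: filterS near_d => p pd /=.
by rewrite /local_expr /= dK ?mem_set.
Qed.

Section no_smooth_conjugacy.
Context {R : realType} (n : nat) {M : topologicalType}.
Variables (A : atlas R M n).
Hypothesis AM : smooth_manifold A.
Local Notation AT := (prod_atlas A (torus2_atlas R)).

Lemma atlas_torus_cover (z : M * torus2 R) : exists i, chart_dom (AT i) z.
Proof.
have [_ _ cov _] := AM; have [m [x [y ->]]] := torus2_surj z.
have [i im] := cov m; exists (i, (x, y)).
by split=> //; split; exact: circle_dom_center.
Qed.

Lemma Ck_map_differentiable (f : M * torus2 R -> M * torus2 R) i j z :
  Ck_map AT AT 1 f -> chart_dom (AT i) z -> chart_dom (AT j) (f z) ->
  differentiable (local_expr (AT i) (AT j) f) (chart_map (AT i) z).
Proof.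
by move=> [_ /(_ i j)[df _]] zi zj; apply: df; apply: mem_set; exists z.
Qed.

(** The target chart is centred at the image point, so that its lifts do not jump nearby and [h]
    appears as the last coordinate along a line. *)
Lemma skew_differentiable_lipschitz_at0 (t : R) (h : R -> R) (m : M) i j :
  periodic h 1 -> continuous h ->
  chart_dom (A i) m ->
  differentiable (local_expr (AT (i, (0, 0))) (AT (j, (t, h 0))) (skew t h))
    (chart_map (AT (i, (0, 0))) (m, (circle_proj 0, circle_proj 0))) ->
  exists L e, 0 < e /\ forall x, `|x| < e -> `|h x - h 0| <= L * `|x|.
Proof.
move=> ph hc mi df.
set F := local_expr _ _ _ in df; set p := chart_map _ _ in df.
(* [v] is the direction of the first angle and [l] the index of the second. *)
pose v : 'rV[R]_(n + (1 + 1)) := row_mx 0 (row_mx (const_mx 1) 0).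
pose l : 'I_(n + (1 + 1)) := rshift n (rshift 1 0).
have := diff_derivable (v := v) df => /derivable_mxP /(_ 0 l).
move=> /cvg_ex[/= d dl].
have [_ ch _ _] := AM; have [_ cK _ _] := ch i.
have FE x : `|h x - h 0| < 2^-1 -> F (x *: v + p) 0 l = h x.
  move=> hx.
  have -> : x *: v + p = row_mx (chart_map (A i) m)
      (row_mx (const_mx x) (const_mx 0) : 'rV_(1 + 1)).
    rewrite /v /p /= !scale_row_mx !add_row_mx !scaler0 !add0r.
    congr (row_mx _ (row_mx _ _)).
      apply/rowP => k; rewrite !mxE mulr1 circle_lift_id ?addr0//; lra.
    apply/rowP => k; rewrite !mxE circle_lift_id//; lra.
  set r := row_mx _ _.
  have rE : chart_inv (AT (i, (0, 0))) r = (m, (circle_proj x, circle_proj 0)).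
    rewrite /r /= !row_mxKl !row_mxKr !row_mxKl !mxE.
    by rewrite cK ?mem_set.
  have -> : F r = chart_map
      (prod_chart (A j) (prod_chart (circle_chart t) (circle_chart (h 0))))
      (m, (circle_proj (x + t), circle_proj (0 + h x))).
    by rewrite -skewE// -rE.
  rewrite /= add0r; apply: (etrans (row_mxEr _ _ 0 (rshift 1 0))).
  apply: (etrans (row_mxEr _ _ 0 0)); rewrite mxE circle_lift_id//.
  move: hx; rewrite ltr_norml; lra.
exists (`|d| + 1).
have near_h : \forall x \near (0 : R), `|h x - h 0| < 2^-1.
  by have /cvgrPdistC_lt := hc 0; apply; rewrite invr_gt0.
have near_q : \forall x \near (0 : R)^', `|x^-1 *: (F (x *: v + p) 0 l - F p 0 l) - d| < 1.
  by move/cvgrPdistC_lt : dl => /(_ 1 ltr01).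
have F0 : F p 0 l = h 0.
  have := FE 0; rewrite scale0r add0r; apply.
  by rewrite subrr normr0 invr_gt0.
have : \forall x \near (0 : R), `|h x - h 0| <= (`|d| + 1) * `|x|.
  have := near_h; move: near_q; rewrite !near_withinE => nq nh.
  near=> x.
  have [->|x0] := eqVneq x 0; first by rewrite subrr !normr0 mulr0.
  have q1 : `|x^-1 * (h x - h 0) - d| < 1.
    rewrite -(FE x); last by near: x.
    by rewrite -F0; move: x0; near: x.
  have -> : h x - h 0 = (x^-1 * (h x - h 0)) * x by field.
  rewrite normrM ler_wpM2r// -[X in `|X|](subrK d) (le_trans (ler_normD _ _))//.
  by rewrite addrC lerD2l ltW.
move=> /nbhs_ballP[e /= e0 eh]; exists e; split=> // x xe; apply: eh.
by rewrite /ball/= sub0r normrN.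
Unshelve. all: by end_near. Qed.

Local Notation alpha := (liouville_number R).
Local Notation rot t := (@skew R M t (fun=> 0)).
Local Notation cob := (fun x : R => rough (x + alpha) - rough x).
Local Notation shear := (@skew R M 0 rough).

Let cst0_periodic : periodic (fun _ : R => 0 : R) 1.
Proof. by []. Qed.

Lemma cob_periodic : periodic cob 1.
Proof. by move=> x /=; rewrite addrAC !rough_periodic. Qed.

Lemma shear_conjugates : conjugates shear (rot alpha) (skew alpha cob).
Proof.
have inv := @skew_inverse R M 0 rough (@rough_periodic R).
eexists; split; first exact: inv.
apply/funext => z; have [_ K] := inv.
rewrite -[in RHS](K z) /=; set w := skew _ _ z.
rewrite (skewD alpha 0 w cst0_periodic (@rough_periodic R)).
rewrite (skewD 0 alpha w (@rough_periodic R) cob_periodic) addr0 add0r.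
by congr (skew _ _ _); apply/funext => x; rewrite /= !addr0 !add0r [RHS]addrC subrK.
Qed.

Lemma rotD s t z : rot s (rot t z) = rot (t + s) z.
Proof. by rewrite skewD//; congr (skew _ _ _); apply/funext => x; rewrite addr0. Qed.

Lemma rot_int (k : int) z : rot k%:~R z = z.
Proof.
have [m [x [y ->]]] := torus2_surj z.
by rewrite skewE// addr0 circle_projD_int.
Qed.

Lemma liouville_gap_lt (e : R) : 0 < e -> exists k, @liouville_gap R k < e.
Proof.
move=> e0; have : (fun k => 2 * 2^-1 ^+ k) @ \oo --> (0 : R).
  by apply: cvg_geometric; rewrite ger0_norm// invf_lt1// ltr1n.
move=> /cvgrPdist_lt /(_ e e0)[N _ /(_ N (leqnn _))] /=.
rewrite sub0r normrN ger0_norm => [h|]; last by rewrite mulr_ge0// exprn_ge0 ?invr_ge0.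
exists N; apply: le_lt_trans h; rewrite (le_trans (liouville_gap_le N))//.
rewrite exprVn ler_pM2l// lef_pV2 ?posrE ?exprn_gt0 ?ltr0n ?liouville_den_gt0//.
have d1 : 1 <= (liouville_den N)%:R :> R by rewrite ler1n liouville_den_gt0.
rewrite (@le_trans _ _ (liouville_den N)%:R)//; last first.
  by rewrite exprS ler_peMr ?(le_trans ler01)// exprn_ege1.
rewrite -natrX ler_nat (leq_trans _ (exp4_le_liouville_den N))//.
by rewrite (_ : 4 = 2 * 2)%N// expnMn leq_pmulr// expn_gt0.
Qed.

(* The set of translations [t] satisfying the conclusion is a closed additive
   monoid containing the integers and [alpha], hence the arbitrarily small numbers
   [liouville_gap k]. *)
Lemma conjugated_half_rotation (psi psi' : M * torus2 R -> M * torus2 R) z :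
  continuous psi -> inverse_maps psi psi' ->
  psi \o rot alpha \o psi' = skew alpha cob ->
  psi (rot 2^-1 (psi' z)) = skew 2^-1 (fun x => - 2 * rough x) z.
Proof.
move=> psic [psiK psi'K] conj.
have inv := @skew_inverse R M 0 rough (@rough_periodic R).
set shear' := skew (- 0) _ in inv; have [shearK shear'K] := inv.
have hM : hausdorff_space (M * torus2 R)%type.
  have [[hM _] _ _ _] := AM; apply: hausdorff_prod => //.
  by apply: hausdorff_prod; exact: circle_hausdorff.
pose D := [set t | forall w, psi (rot t (psi' w)) = shear (rot t (shear' w))].
have Dalpha : D alpha.
  move=> w; rewrite -[LHS]/((psi \o rot alpha \o psi') w) conj.
  (* [s] is the inverse hidden in [conjugates]; it is identified with [shear'] by cancellation. *)
  have [s [[sK s'K] <-]] := shear_conjugates.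
  by rewrite /=; congr (shear (rot _ _)); rewrite -[LHS]shearK s'K.
have Dint (k : int) : D k%:~R by move=> w; rewrite !rot_int psi'K shear'K.
have DD s t : D s -> D t -> D (s + t).
  by move=> Ds Dt w; rewrite -!rotD -[rot s (psi' w)]psiK Dt Ds shearK.
have Dmul (k : nat) t : D t -> D (k%:R * t).
  move=> Dt; elim: k => [|k IH]; first by rewrite mul0r; exact: (Dint 0).
  by rewrite -natr1 mulrDl mul1r; exact: DD.
have Dgap k : D (liouville_gap k).
  have [N NE] := @liouville_numberE R k.
  have -> : liouville_gap k = (liouville_den k)%:R * alpha + (- N%:Z)%:~R.
    by rewrite NE mulrNz addrK.
  by apply: DD; [exact: Dmul|exact: Dint].
have Dhalf : closure D 2^-1.
  move=> B /nbhs_ballP[e /= e0 eB].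
  have [k ke] := liouville_gap_lt e0; have k0 := @liouville_gap_gt0 R k.
  set d := liouville_gap k in ke k0.
  (* With [N] the integer part of [2^-1 / d], the multiple [N * d] lies below 1/2 by less than
     [d < e]. *)
  have /truncn_itv : 0 <= 2^-1 / d by rewrite divr_ge0// ltW.
  set N := Num.truncn _; rewrite ler_pdivlMr// ltr_pdivrMr// => /andP[N1 N2].
  exists (N%:R * d); split; first exact/Dmul/Dgap.
  apply: eB; rewrite /ball/= ger0_norm ?subr_ge0//.
  by move: N2; rewrite -[N.+1]addn1 natrD mulrDl mul1r; lra.
have shc : continuous shear.
  by apply: skew_continuous; [exact: rough_periodic|exact: rough_continuous].
have Lc : continuous (fun t => psi (rot t (psi' z))).
  move=> t; apply: continuous_comp; [exact: skew_orbit_continuous|exact: psic].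
have Rc : continuous (fun t => shear (rot t (shear' z))).
  move=> t; apply: continuous_comp; [exact: skew_orbit_continuous|exact: shc].
rewrite (continuous_eq_limit_point hM Lc Rc _ Dhalf)//.
have p1 : periodic (fun x : R => - rough (x - 0)) 1.
  by move=> x; rewrite addrAC rough_periodic.
have p2 : periodic (fun x : R => - rough (x - 0) + 0) 1.
  by move=> x; rewrite addrAC rough_periodic.
rewrite /shear' (skewD _ _ z p1 cst0_periodic) (skewD _ _ z p2 (@rough_periodic R)).
congr (skew _ _ _); first by rewrite oppr0 add0r addr0.
apply/funext => x; rewrite oppr0 !addr0 add0r rough_half_period; ring.
Qed.

Lemma no_C1_conjugacy (m : M) :
  ~ exists2 psi, Ck_diffeo AT AT 1 psi & conjugates psi (rot alpha) (skew alpha cob).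
Proof.
move=> [psi [Cpsi [psi'' [inv'' Cpsi'']]] [psi' [inv' conj]]].
have psi'E : psi'' = psi'.
  (* The inverse that is C^1 and the inverse that appears in the conjugacy are the same map. *)
  by apply/funext => z; rewrite -[in LHS](inv'.2 z) inv''.1.
rewrite psi'E in Cpsi''.
have h z := conjugated_half_rotation z Cpsi.1 inv' conj.
pose Phi := @skew R M 2^-1 (fun x => - 2 * rough x).
(* As a composite of three C^1 maps, [Phi] is differentiable; the charts [d1] and [d2] below cover
   the two intermediate points. *)
have PhiE : Phi = psi \o (rot 2^-1 \o psi') by apply/funext => z; rewrite /= h.
pose g x : R := - 2 * rough x.
have pg : periodic g 1 by move=> x; rewrite /g rough_periodic.
have gc : continuous g.
  by move=> x; apply: cvgM; [exact: cvg_cst|exact: rough_continuous].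
have [_ _ cov _] := AM; have [i mi] := cov m.
pose z : M * torus2 R := (m, (circle_proj 0, circle_proj 0)).
pose c : atlas_index AT := (i, (0, 0)).
pose e : atlas_index AT := (i, (2^-1, g 0)).
have zc : chart_dom (AT c) z by split=> //; split; exact: circle_dom_center.
have ze : chart_dom (AT e) (Phi z).
  rewrite /Phi /z skewE// !add0r; split=> //; split; exact: circle_dom_center.
have [d1 zd1] := atlas_torus_cover (psi' z).
have [d2 zd2] := atlas_torus_cover (rot 2^-1 (psi' z)).
have ch := is_chart_atlas_torus AM.
have rotC1 : Ck_map AT AT 1 (rot 2^-1).
  by have [] := diffeo_skew 2^-1 AM cst0_periodic (@smooth_fun_cst R 0) 1%N.
have D1 := Ck_map_differentiable Cpsi'' zc zd1.
have D2 := Ck_map_differentiable rotC1 zd1 zd2.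
have zd3 : chart_dom (AT e) (psi (rot 2^-1 (psi' z))) by rewrite (h z).
have D3 := Ck_map_differentiable Cpsi zd2 zd3.
have D12 := differentiable_local_expr_comp (ch c) (ch d1) zc zd1 Cpsi''.1 D1 D2.
have rc : continuous (rot 2^-1 \o psi').
  move=> w; apply: continuous_comp; [exact: Cpsi''.1|exact: rotC1.1].
have D123 := differentiable_local_expr_comp (ch c) (ch d2) zc zd2 rc D12 D3.
rewrite -PhiE in D123.
have [L [r [r0 Lr]]] := skew_differentiable_lipschitz_at0 pg gc mi D123.
apply: (@rough_not_lipschitz_at0 R (L / 2) r r0) => x xr.
have := Lr x xr; rewrite /g -mulrBr normrM normrN (ger0_norm (ler0n _ 2)).
lra.
Qed.

End no_smooth_conjugacy.

Theorem proposition10p4 (R : realType) (n : nat) (M : topologicalType)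
    (A : atlas R M n) (M_manifold : smooth_manifold A)
    (M_nonempty : [set: M] !=set0) :
  let AT := prod_atlas A (torus2_atlas R) in
  (exists phi1 phi2 : M * torus2 R -> M * torus2 R,
     [/\ diffeo AT AT phi1,
         diffeo AT AT phi2,
         exists2 psi, homeomorphism psi & conjugates psi phi1 phi2 &
         ~ exists2 psi, Ck_diffeo AT AT 1 psi & conjugates psi phi1 phi2]) /\
  (forall mu : top_form A, volume_form mu ->
   let nu := prod_form mu (torus2_form R) in
   exists phi1 phi2 : M * torus2 R -> M * torus2 R,
     [/\ diffeo AT AT phi1 /\ diffeo AT AT phi2,
         [/\ pulls_back phi1 nu nu, preserves_volume nu phi1,
             pulls_back phi2 nu nu & preserves_volume nu phi2],
         exists2 psi, homeomorphism psi /\ preserves_volume nu psi &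
                      conjugates psi phi1 phi2 &
         ~ exists2 psi, Ck_diffeo AT AT 1 psi & conjugates psi phi1 phi2]).
Proof.
move=> AT; have [m _] := M_nonempty.
pose alpha := liouville_number R.
pose cob x : R := rough (x + alpha) - rough x.
have p0 : periodic (fun _ : R => 0 : R) 1 by [].
have s0 := @smooth_fun_cst R 0.
have pc : periodic cob 1 := @cob_periodic R.
have sc : smooth_fun cob := rough_coboundary_smooth.
have pr := @rough_periodic R; have rc := @rough_continuous R.
pose phi1 := @skew R M alpha (fun=> 0); pose phi2 := @skew R M alpha cob.
have d1 : diffeo AT AT phi1 by exact: diffeo_skew.
have d2 : diffeo AT AT phi2 by exact: diffeo_skew.
have hpsi : homeomorphism (@skew R M 0 rough) by exact: skew_homeomorphism.
have cpsi := @shear_conjugates R M.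
have noC1 := no_C1_conjugacy M_manifold m.
(* One pair and one shear serve both claims, whatever [mu] is. *)
split=> [|mu vmu nu]; exists phi1, phi2.
  by split=> //; exists (skew 0 rough).
have pv (g : R -> R) (t : R) : periodic g 1 -> continuous g -> preserves_volume nu (skew t g).
  by move=> pg gc; exact: preserves_volume_skew.
split=> //.
- split.
  + exact: pulls_back_skew.
  + exact: pv (smooth_fun_continuous s0).
  + exact: pulls_back_skew.
  + exact: pv (smooth_fun_continuous sc).
- by exists (skew 0 rough) => //; split=> //; exact: pv.
Qed.
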